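(* Let $\alpha\in FT_1$ and $0\le b<c$. Suppose that $\nu$ is a probability on $\mathbb{R}$ with $\nu=\mu(a\alpha)$ for all $a\in(b,c)$. Then $\alpha=\nu$, and $\alpha$ is Cauchy or Dirac.
   Context: $FT_1$ is the set of probabilities $\alpha$ on $\mathbb{R}$ with $\int\log(1+|x|)\alpha(dx)<\infty$. For $\alpha\in FT_1$ and $t>0$, let $B_1,Y_1,B_2,Y_2,\ldots$ be independent with $B_k\sim\alpha$ and $Y_k\sim\beta(1,t)$ (density $t(1-y)^{t-1}$ on $(0,1)$), and put $W_1=Y_1$, $W_k=Y_k(1-Y_{k-1})\cdots(1-Y_1)$ for $k>1$. The series $X_t=\sum_{k\ge1}W_kB_k$ converges absolutely almost surely, and $\mu(t\alpha)$ denotes its distribution (it is the law of $\int x\,P_t(dx)$ for a Dirichlet random probability $P_t=\sum_k W_k\delta_{B_k}\sim\mathcal{D}(t\alpha)$). ''Cauchy'' means $\alpha(dx)=\frac1\pi\frac{q\,dx}{(x-p)^2+q^2}$ for some $p\in\mathbb{R}$, $q>0$; ''Dirac'' means $\alpha=\delta_p$ for some $p\in\mathbb{R}$. *)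

(* Defs.v *)
From HB Require Import structures.
From mathcomp Require Import all_boot all_order all_algebra.
From mathcomp Require Import all_classical all_reals all_analysis.

Set Implicit Arguments.
Unset Strict Implicit.
Unset Printing Implicit Defensive.

Import Order.TTheory GRing.Theory Num.Theory.
Import numFieldNormedType.Exports.

Local Open Scope classical_set_scope.
Local Open Scope ring_scope.

(* Library measures are functions on all subsets of R, with junk values on
   non-measurable sets, so Leibniz equality would be too strong. *)
Definition eq_law (R : realType) (m1 m2 : set (measurableTypeR R) -> \bar R) :
  Prop :=
  forall A : set (measurableTypeR R), measurable A -> m1 A = m2 A.

Definition FT1 (R : realType) (alpha : probability (measurableTypeR R) R) :
  Prop :=
  (\int[alpha]_x (ln (1 + `|x|))%:E < +oo)%E.

Definition mutually_independent (R : realType) (d : measure_display)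
    (T : measurableType d) (P : probability T R) (I : eqType)
    (Z : I -> {RV P >-> measurableTypeR R}) : Prop :=
  forall (s : seq I) (A : I -> set (measurableTypeR R)),
    uniq s -> (forall i, measurable (A i)) ->
    P (\bigcap_(i in [set` s]) (Z i @^-1` A i)) =
    (\prod_(i <- s) P (Z i @^-1` A i))%E.

(* The library's beta_prob only allows natural number parameters. *)
Definition beta1_law (R : realType) (t : R) (A : set (measurableTypeR R)) :
  \bar R :=
  (\int[lebesgue_measure]_(y in A `&` `]0%R, 1%R[)
     (t * (1 - y) `^ (t - 1))%:E)%E.

(* Sequences start at index 0: for Y_(k+1) = y k, stick_weight y k is W_(k+1). *)
Definition stick_weight (R : realType) (y : nat -> R) (k : nat) : R :=
  y k * \prod_(j < k) (1 - y j).

(* nu = mu(t alpha).  The law of the series depends only on the joint law of the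
   sequences B and Y, so it does not matter which realization of them on a
   probability space is chosen; X is any measurable version of the almost sure
   sum. *)
Definition is_mu (R : realType) (t : R)
    (alpha nu : probability (measurableTypeR R) R) : Prop :=
  exists (d : measure_display) (T : measurableType d) (P : probability T R)
         (B Y : nat -> {RV P >-> measurableTypeR R})
         (X : {RV P >-> measurableTypeR R}),
    [/\ mutually_independent
          (fun i : nat + nat => match i with inl k => B k | inr k => Y k end),
        forall k, eq_law (distribution P (B k)) alpha,
        forall k, eq_law (distribution P (Y k)) (beta1_law t),
        {ae P, forall w,
          series (fun k => stick_weight (fun j => Y j w) k * B k w) @ \oo
            --> (X w : R)} &
        eq_law (distribution P X) nu].

Definition is_cauchy (R : realType)
    (alpha : probability (measurableTypeR R) R) : Prop :=
  exists p q : R, 0 < q /\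
    eq_law alpha (fun A =>
      \int[lebesgue_measure]_(x in A)
        (pi^-1 * (q / ((x - p) ^+ 2 + q ^+ 2)))%:E)%E.

Definition is_dirac (R : realType)
    (alpha : probability (measurableTypeR R) R) : Prop :=
  exists p : R, eq_law alpha (dirac (p : measurableTypeR R)).

(* Main.v *)
Require Import Defs.
From HB Require Import structures.
From mathcomp Require Import all_boot all_order all_algebra.
From mathcomp Require Import all_classical all_reals all_analysis.
From mathcomp Require Import measurable_realfun ring lra.

(** A stick-breaking series satisfies X = Y B + (1 - Y) X' in law, with
    Y ~ beta(1, a), B ~ alpha and X' ~ nu independent.  Hence, for f bounded and
    continuous and psi(s) = E f(s X + (1 - s) B),
      E f(X) = int_0^1 a s^(a - 1) psi(s) ds   for all a in (b, c).
    Since psi does not depend on a, uniqueness of the Mellin transform on an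
    interval forces psi to be constant.  Letting s -> 0 gives alpha = nu, and then
    s X + (1 - s) X' = X in law for independent X, X' ~ nu and all s in [0, 1].

    Integrating E (s z1 + (1 - s) z2 - s X - (1 - s) X')^(-2) over s in [0, 1]
    and using int_0^1 (s A + (1 - s) B)^(-2) ds = 1 / (A B), the Stieltjes transform
    G(z) = E (z - X)^(-1) satisfies
      G(z1) G(z2) = E 1 / ((z1 - X) (z2 - X)) = (G(z1) - G(z2)) / (z2 - z1)
    on the upper half plane, so 1 / G(z) - z is constant: G(z) = 1 / (z - p + i q)
    with q >= 0.  This is the transform of the Dirac law at p when q = 0 and of a
    Cauchy law when q > 0. *)

Set Implicit Arguments.
Unset Strict Implicit.
Unset Printing Implicit Defensive.

Import Order.TTheory GRing.Theory Num.Theory.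
Import numFieldNormedType.Exports.

Local Open Scope classical_set_scope.
Local Open Scope ring_scope.

(** * Bounded measurable functions *)

(** The parameter a ranges over a bounded interval only, so no limit in a is available. With s =
    exp(-l), all beta(1, a) are exponential tilts of one beta(1, a0), and the Mellin transform
    becomes a Laplace transform in the tilt th = a - a0. As a0 is interior, l has an exponential
    moment; hence vanishing for small th propagates in steps of fixed length r to every th = k r.
    This annihilates all polynomials in exp(-r l), and polynomials peaked at a point contradict a
    nonzero value of the continuous function psi - C there.

    Stability only speaks of functions of the single variable s X + (1 - s) X'. The inverse square
    is chosen because its average over s splits into a product of a function of X and a function of
    X'; the same average on the diagonal X = X' gives the other side of the product formula.

    Complex quantities are carried as pairs of real and imaginary parts. Only Im G is needed to
    recover the law: its boundary behaviour gives the atoms and the masses of intervals (Stieltjes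
    inversion). *)

Definition bmf d (T : measurableType d) (R : realType) (f : T -> R) : Prop :=
  measurable_fun setT f /\ exists M, forall x, `|f x| <= M.

Section bmf_theory.
Context d (T : measurableType d) (R : realType).
Implicit Types (f g : T -> R) (P : probability T R).

Lemma bmf_cst (k : R) : bmf (fun _ : T => k).
Proof. by split=> //; exists `|k|. Qed.

Lemma bmfN f : bmf f -> bmf (fun x => - f x).
Proof.
move=> [mf [M fM]]; split; first exact: measurableT_comp.
by exists M => x; rewrite normrN.
Qed.

Lemma bmfD f g : bmf f -> bmf g -> bmf (fun x => f x + g x).
Proof.
move=> [mf [M fM]] [mg [N gN]]; split; first exact: measurable_funD.
by exists (M + N) => x; rewrite (le_trans (ler_normD _ _))// lerD.
Qed.

Lemma bmfB f g : bmf f -> bmf g -> bmf (fun x => f x - g x).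
Proof. by move=> bf /bmfN; exact: bmfD. Qed.

Lemma bmfM f g : bmf f -> bmf g -> bmf (fun x => f x * g x).
Proof.
move=> [mf [M fM]] [mg [N gN]]; split; first exact: measurable_funM.
by exists (M * N) => x; rewrite normrM ler_pM.
Qed.

Lemma bmfX f n : bmf f -> bmf (fun x => f x ^+ n).
Proof.
move=> bf; elim: n => [|n ih]; first exact: bmf_cst.
under [X in bmf X]funext do rewrite exprS.
exact: bmfM.
Qed.

Lemma bmf_comp d' (T' : measurableType d') (h : T' -> T) f :
  measurable_fun setT h -> bmf f -> bmf (f \o h).
Proof.
move=> mh [mf [M fM]]; split; first exact: measurableT_comp.
by exists M => x /=.
Qed.

(** This is what makes bounded measurable functions a convenient class: under a probability,
    integrability and the hypothesis of Fubini come for free. *)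
Lemma bmf_integrable P f : bmf f -> P.-integrable setT (EFin \o f).
Proof.
move=> [mf [M fM]]; apply: (@le_integrable _ _ _ P _ _ _ (fun=> M%:E)) => //.
- exact/measurable_EFinP.
- by move=> x _ /=; rewrite lee_fin (le_trans (fM x))// ler_norm.
- by apply: finite_measure_integrable_cst.
Qed.

Lemma EFin_bmf_int P f : bmf f ->
  (\int[P]_x f x)%:E = (\int[P]_x (f x)%:E)%E.
Proof.
by move=> bf; rewrite fineK//; apply: integrable_fin_num => //; exact: bmf_integrable.
Qed.

Lemma bmf_intD P f g : bmf f -> bmf g ->
  \int[P]_x (f x + g x) = \int[P]_x f x + \int[P]_x g x.
Proof. by move=> bf bg; apply: RintegralD => //; exact: bmf_integrable. Qed.

Lemma bmf_intB P f g : bmf f -> bmf g ->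
  \int[P]_x (f x - g x) = \int[P]_x f x - \int[P]_x g x.
Proof. by move=> bf bg; apply: RintegralB => //; exact: bmf_integrable. Qed.

Lemma bmf_intZl P f k : bmf f ->
  \int[P]_x (k * f x) = k * \int[P]_x f x.
Proof. by move=> bf; apply: RintegralZl => //; exact: bmf_integrable. Qed.

Lemma bmf_intZr P f k : bmf f ->
  \int[P]_x (f x * k) = \int[P]_x f x * k.
Proof. by move=> bf; apply: RintegralZr => //; exact: bmf_integrable. Qed.

Lemma prob_int_cst P (k : R) : \int[P]_x k = k.
Proof. by rewrite Rintegral_cst//= [P _]probability_setT mulr1. Qed.

Lemma bmf_le_int P f g : bmf f -> bmf g -> (forall x, f x <= g x) ->
  \int[P]_x f x <= \int[P]_x g x.
Proof. by move=> bf bg fg; apply: le_Rintegral => //; exact: bmf_integrable. Qed.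

Lemma bmf_int_norm P f M : bmf f -> (forall x, `|f x| <= M) ->
  `|\int[P]_x f x| <= M.
Proof.
move=> bf fM; move=> *; rewrite -[X in _ <= X](prob_int_cst P).
apply: (le_trans (le_normr_Rintegral _ _)) => //; first exact: bmf_integrable.
apply: bmf_le_int => //; last exact: bmf_cst.
case: bf => mf _; split; first exact: measurableT_comp.
by exists M => x; rewrite normr_id.
Qed.

Lemma bmf_dct P (f_ : nat -> T -> R) f M :
  (forall n, measurable_fun setT (f_ n)) -> measurable_fun setT f ->
  (forall n x, `|f_ n x| <= M) ->
  {ae P, forall x, f_ n x @[n --> \oo] --> f x} ->
  \int[P]_x f_ n x @[n --> \oo] --> \int[P]_x f x.
Proof.
move=> mf_ mf f_M f_f.
have bf_ n : bmf (f_ n) by split => //; exists M.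
have [|||||intf _ h] := @dominated_convergence _ _ _ P setT measurableT
  (fun n => EFin \o f_ n) (EFin \o f) (fun=> M%:E).
- by move=> n; exact/measurable_EFinP.
- exact/measurable_EFinP.
- by apply: filterS f_f => x fx _; apply: cvg_EFin => //; exact: nearW.
- exact: finite_measure_integrable_cst.
- by apply: nearW => x n _; rewrite /= lee_fin.
- rewrite /Rintegral; apply: fine_cvg; rewrite fineK//; exact: integrable_fin_num.
Qed.

End bmf_theory.

Section bmf_fubini.
Context d1 d2 (T1 : measurableType d1) (T2 : measurableType d2) (R : realType).
Variables (P : probability T1 R) (Q : probability T2 R) (F : T1 * T2 -> R).
Hypothesis bF : bmf F.

Lemma bmf_slice1 x : bmf (fun y => F (x, y)).
Proof. by apply: (@bmf_comp _ _ _ _ _ (pair x)) => //; exact: measurable_pair1. Qed.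

Lemma bmf_slice2 y : bmf (fun x => F (x, y)).
Proof. by apply: (@bmf_comp _ _ _ _ _ (pair^~ y)) => //; exact: measurable_pair2. Qed.

Lemma bmf_int1 : bmf (fun x => \int[Q]_y F (x, y)).
Proof.
case: (bF) => mF [M FM]; split; last first.
  by exists M => x; apply: bmf_int_norm => //; exact: bmf_slice1.
apply: measurableT_comp => //.
apply: (@measurable_fubini_F _ _ _ _ _ P Q (EFin \o F)).
exact: (bmf_integrable (P \x Q)%E).
Qed.

Lemma bmf_int2 : bmf (fun y => \int[P]_x F (x, y)).
Proof.
case: (bF) => mF [M FM]; split; last first.
  by exists M => x; apply: bmf_int_norm => //; exact: bmf_slice2.
apply: measurableT_comp => //.
apply: (@measurable_fubini_G _ _ _ _ _ P Q (EFin \o F)).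
exact: (bmf_integrable (P \x Q)%E).
Qed.

Lemma bmf_fubini :
  \int[P]_x \int[Q]_y F (x, y) = \int[Q]_y \int[P]_x F (x, y).
Proof.
apply/EFin_inj; rewrite !EFin_bmf_int; [|exact: bmf_int2|exact: bmf_int1].
transitivity (\int[P]_x (\int[Q]_y (EFin \o F) (x, y)))%E.
  by apply: eq_integral => x _; rewrite EFin_bmf_int//; exact: bmf_slice1.
rewrite Fubini; last exact: (bmf_integrable (P \x Q)%E).
by apply: eq_integral => y _; rewrite EFin_bmf_int//; exact: bmf_slice2.
Qed.

End bmf_fubini.

(** * Independence and the stick-breaking chain *)

Section pair_independence.
Context d d1 d2 (T : measurableType d) (T1 : measurableType d1)
  (T2 : measurableType d2) (R : realType) (P : probability T R).
Variables (U : T -> T1) (V : T -> T2).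
Hypotheses (mU : measurable_fun setT U) (mV : measurable_fun setT V).

Let mUV : measurable_fun setT (fun w => (U w, V w)).
Proof. exact: measurable_fun_pair. Qed.

(** Rectangles form a pi-system generating the product sigma-algebra, and both sides are finite
    measures in [Q]. Nothing is assumed about the dependence between [U] and [V]. *)
Lemma indep_pair_event (E : set T) : measurable E ->
  (forall A C, measurable A -> measurable C ->
    P (U @^-1` A `&` V @^-1` C `&` E) = P (U @^-1` A `&` V @^-1` C) * P E)%E ->
  forall Q, measurable Q ->
    (P ((fun w => (U w, V w)) @^-1` Q `&` E) =
     P ((fun w => (U w, V w)) @^-1` Q) * P E)%E.
Proof.
move=> mE H Q mQ.
pose UV : {mfun T >-> (T1 * T2)%type} :=
  HB.pack (fun w => (U w, V w)) (isMeasurableFun.Build _ _ _ _ _ mUV).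
have PEfin : P E \is a fin_num by exact: fin_num_measure.
have PE0 : 0 <= fine (P E) by exact: fine_ge0.
pose m1 : {measure set (T1 * T2)%type -> \bar R} := pushforward (mrestr P mE) UV.
pose m2 : {measure set (T1 * T2)%type -> \bar R} := mscale (NngNum PE0) (distribution P UV).
rewrite [RHS]muleC -(fineK PEfin).
have := @measure_unique _ R _
  [set A `*` B | A in @measurable _ T1 & B in @measurable _ T2] (fun=> setT)
  _ _ _ _ (m1 mUV) m2 _ _ Q mQ.
apply.
- exact: measurable_prod_measurableType.
- move=> _ _ [A mA [B mB <-]] [A' mA' [B' mB' <-]].
  rewrite -setXI; exists (A `&` A'); first exact: measurableI.
  by exists (B `&` B') => //; exact: measurableI.
- by move=> _; exists setT => //; exists setT => //; rewrite setXTT.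
- by rewrite bigcup_const.
- move=> _ [A mA [B mB <-]].
  transitivity (P (U @^-1` A `&` V @^-1` B `&` E)); first by [].
  by rewrite H// muleC -(fineK PEfin).
- move=> _; rewrite /m1 /pushforward /mrestr.
  apply: le_lt_trans (ltry 1); suff -> : m1 mUV setT = P E by exact: probability_le1.
  by rewrite -[in RHS](setTI E).
Qed.

Variable gamma : probability T2 R.
Hypothesis lawV : forall C, measurable C -> P (V @^-1` C) = gamma C.
Hypothesis indepUV : forall A C, measurable A -> measurable C ->
    (P (U @^-1` A `&` V @^-1` C) = P (U @^-1` A) * P (V @^-1` C))%E.

(** Only [V] is replaced by its law while [U] stays on the original space, so that the variables of
    a chain can be integrated out one at a time. *)
Lemma integral_indep_pair (F : T1 * T2 -> \bar R) :
  measurable_fun setT F -> (forall x, 0 <= F x)%E ->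
  (\int[P]_w F (U w, V w) = \int[P]_w \int[gamma]_y F (U w, y))%E.
Proof.
move=> mF F0.
pose fU : {mfun T >-> T1} := HB.pack U (isMeasurableFun.Build _ _ _ _ _ mU).
pose fUV : {mfun T >-> (T1 * T2)%type} :=
  HB.pack (fun w => (U w, V w)) (isMeasurableFun.Build _ _ _ _ _ mUV).
pose lU : probability T1 R := distribution P fU.
pose lUV : probability _ R := distribution P fUV.
have key Q : measurable Q -> (lU \x gamma)%E Q = lUV Q.
  move=> mQ; apply: (@product_measure_unique _ _ _ _ _ lU gamma lUV) => // A C mA mC.
  transitivity (P (U @^-1` A `&` V @^-1` C)); first by [].
  by rewrite indepUV// lawV.
rewrite -[LHS](@ge0_integral_distribution _ _ _ _ _ P fUV F mF F0).
rewrite -[RHS](@ge0_integral_distribution _ _ _ _ _ P fU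
  (fubini_F gamma F)); last 2 first.
- exact: measurable_fun_fubini_tonelli_F.
- by move=> y; exact: integral_ge0.
rewrite -[RHS](@fubini_tonelli1 _ _ _ _ _ lU gamma F mF F0).
apply: eq_measure_integral => Q mQ _; exact/esym/key.
Qed.

End pair_independence.

Section mutual_independence.
Context (R : realType) d (T : measurableType d) (P : probability T R) (I : eqType).
Variable Z : I -> {RV P >-> measurableTypeR R}.
Hypothesis Zind : mutually_independent Z.

Let cyl (A : I -> set (measurableTypeR R)) (s : seq I) :=
  \bigcap_(i in [set` s]) (Z i @^-1` A i).

Lemma cyl_cons A i s : cyl A (i :: s) = Z i @^-1` A i `&` cyl A s.
Proof.
rewrite /cyl -(bigcap_setU1 (fun i => Z i @^-1` A i)); congr bigcap.
apply/seteqP; split => j /=.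
  by rewrite inE => /predU1P[]; [left|right].
by move=> [->|js]; rewrite inE ?eqxx// js orbT.
Qed.

Lemma cyl_nil A : cyl A [::] = setT.
Proof. by rewrite /cyl set_nil bigcap_set0. Qed.

Lemma measurable_cyl A s : (forall i, measurable (A i)) -> measurable (cyl A s).
Proof.
move=> mA; elim: s => [|i s ih]; first by rewrite cyl_nil.
by rewrite cyl_cons; apply: measurableI => //; exact: measurable_funPTI.
Qed.

Lemma cyl_indep A i s : uniq (i :: s) -> (forall i, measurable (A i)) ->
  P (cyl A (i :: s)) = (P (Z i @^-1` A i) * P (cyl A s))%E.
Proof.
move=> us mA; rewrite /cyl !Zind//; first by rewrite big_cons.
by case/andP: us.
Qed.

Lemma cyl_update A i s C : i \notin s ->
  Z i @^-1` C `&` cyl A s = cyl (fun j => if j == i then C else A j) (i :: s).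
Proof.
move=> si; rewrite cyl_cons eqxx; congr (_ `&` _).
apply: eq_bigcapr => j /= js; case: eqP => // ji.
by move: si; rewrite -ji js.
Qed.

End mutual_independence.

(** * Stick-breaking as a Markov chain *)

Section stick_breaking_chain.
Context (R : realType) d (T : measurableType d) (P : probability T R).
Variables B Y : nat -> {RV P >-> measurableTypeR R}.

Let Z (i : nat + nat) := match i with inl k => B k | inr k => Y k end.
Hypothesis Zind : mutually_independent Z.

(** The state consists of the partial sum of the series and the length of stick that is still
    unbroken; the pair is Markov, the partial sum alone is not. *)
Definition stick_step (v : measurableTypeR R * measurableTypeR R)
    (y b : measurableTypeR R) : measurableTypeR R * measurableTypeR R :=
  (v.1 + v.2 * y * b, v.2 * (1 - y)).

Fixpoint stick_chain n (w : T) : measurableTypeR R * measurableTypeR R :=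
  if n is n'.+1 then stick_step (stick_chain n' w) (Y n' w) (B n' w)
  else (0, 1).

Lemma stick_chainE n w : stick_chain n w =
  (series (fun k => stick_weight (fun j => Y j w) k * B k w) n,
   \prod_(j < n) (1 - Y j w)).
Proof.
elim: n => [|n ih]; first by rewrite /series/= big_geq// big_ord0.
rewrite /= ih /stick_step /= !seriesEord/= !big_ord_recr/=; congr (_ + _, _).
by rewrite /stick_weight [X in X * _]mulrC.
Qed.

Lemma measurable_stick_step d0 (X : measurableType d0) (f : X -> _)
    (g h : X -> measurableTypeR R) :
  measurable_fun setT f -> measurable_fun setT g -> measurable_fun setT h ->
  measurable_fun setT (fun x => stick_step (f x) (g x) (h x)).
Proof.
move=> mf mg mh.
have mf1 : measurable_fun setT (fun x => (f x).1) by exact: measurableT_comp.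
have mf2 : measurable_fun setT (fun x => (f x).2) by exact: measurableT_comp.
apply: measurable_fun_pair.
  apply: measurable_funD => //; apply: measurable_funM => //; exact: measurable_funM.
by apply: measurable_funM => //; exact: measurable_funB.
Qed.

Lemma measurable_stick_chain n : measurable_fun setT (stick_chain n).
Proof. by elim: n => [|n ih] //=; exact: measurable_stick_step. Qed.

Let idx (i : nat + nat) := match i with inl k => k | inr k => k end.
Let cyl (A : nat + nat -> set (measurableTypeR R)) (s : seq (nat + nat)) :=
  \bigcap_(i in [set` s]) (Z i @^-1` A i).
Let lt_idx n (s : seq (nat + nat)) := all (fun i => n <= idx i)%N s.

(** Independence of the past from the future, tested on cylinders because this is the form in which
    mutual independence is given. Allowing every cylinder makes it an induction hypothesis: an event
    on the next variable can be absorbed into the cylinder. *)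
Let future_free n := forall D s A, measurable D -> uniq s -> lt_idx n s ->
  (forall i, measurable (A i)) ->
  (P (stick_chain n @^-1` D `&` cyl A s) = P (stick_chain n @^-1` D) * P (cyl A s))%E.

Let future_freeY n : future_free n -> forall D s A, measurable D ->
  uniq (inr n :: s) -> lt_idx n s -> (forall i, measurable (A i)) ->
  (P ((fun w => (stick_chain n w, Y n w)) @^-1` D `&` cyl A s) =
   P ((fun w => (stick_chain n w, Y n w)) @^-1` D) * P (cyl A s))%E.
Proof.
move=> H D s A mD us ns mA.
have mS := measurable_stick_chain n.
apply: indep_pair_event => //; first exact: measurable_cyl.
move=> D' C mD' mC; have /andP[si us'] := us.
(* The event on [Y n] is moved into the cylinder, where the hypothesis on the chain applies, and is
   then split off again by independence. *)
pose A' j := if j == inr n then C else A j.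
have mA' i : measurable (A' i) by rewrite /A'; case: ifP.
have e1 : Y n @^-1` C `&` cyl A s = cyl A' (inr n :: s).
  exact: (@cyl_update _ _ _ _ _ Z A (inr n) s C).
have e2 : Y n @^-1` C = cyl A' [:: inr n].
  by rewrite /cyl (@cyl_cons _ _ _ _ _ Z) (@cyl_nil _ _ _ _ _ Z) setIT /A' eqxx.
rewrite -setIA e1 H//=; last by rewrite leqnn.
rewrite e2 H//=; last by rewrite leqnn.
rewrite -muleA; congr (_ * _)%E.
rewrite -[in RHS]e2 /cyl (@cyl_indep _ _ _ _ _ Z Zind)// /A' eqxx; congr (_ * P _)%E.
apply: eq_bigcapr => j /= js; case: eqP => // ji.
by move: si; rewrite -ji js.
Qed.

Let future_freeYB n : future_free n -> forall D s A, measurable D ->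
  uniq s -> lt_idx n.+1 s -> (forall i, measurable (A i)) ->
  (P ((fun w => ((stick_chain n w, Y n w), B n w)) @^-1` D `&` cyl A s) =
   P ((fun w => ((stick_chain n w, Y n w), B n w)) @^-1` D) * P (cyl A s))%E.
Proof.
move=> H D s A mD us ns mA.
have mS := measurable_stick_chain n.
have ns' : lt_idx n s by apply: sub_all ns => i; exact: ltnW.
have nin i : idx i = n -> i \notin s.
  by move=> ii; apply/negP => /(allP ns); rewrite ii ltnn.
apply: indep_pair_event => //; first exact: measurable_fun_pair.
  exact: measurable_cyl.
move=> D' C mD' mC.
pose A' j := if j == inl n then C else A j.
have mA' i : measurable (A' i) by rewrite /A'; case: ifP.
have e1 : B n @^-1` C `&` cyl A s = cyl A' (inl n :: s).
  by apply: (@cyl_update _ _ _ _ _ Z A (inl n) s C); exact: nin.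
have e2 : B n @^-1` C = cyl A' [:: inl n].
  by rewrite /cyl (@cyl_cons _ _ _ _ _ Z) (@cyl_nil _ _ _ _ _ Z) setIT /A' eqxx.
rewrite -setIA e1 future_freeY//=; last 2 first.
- by rewrite inE negb_or/= !nin.
- by rewrite leqnn.
rewrite e2 future_freeY//=; last by rewrite leqnn.
rewrite -muleA; congr (_ * _)%E.
rewrite -[in RHS]e2 /cyl (@cyl_indep _ _ _ _ _ Z Zind)//= ?nin// /A' eqxx.
congr (_ * P _)%E.
apply: eq_bigcapr => j /= js; case: eqP => // ji.
by have := @nin (inl n) erefl; rewrite -ji js.
Qed.

Let future_free_all n : future_free n.
Proof.
elim: n => [|n ih] D s A mD us ns mA.
  have [D01|D01] := pselect (D (0, 1)).
    suff -> : stick_chain 0 @^-1` D = setT by rewrite setTI [P setT]probability_setT mul1e.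
    by apply/seteqP; split.
  suff -> : stick_chain 0 @^-1` D = set0 by rewrite set0I !measure0 mul0e.
  by apply/seteqP; split.
set W := fun w => ((stick_chain n w, Y n w), B n w).
pose h (u : (measurableTypeR R * measurableTypeR R) *
    measurableTypeR R * measurableTypeR R) :=
  stick_step u.1.1 u.1.2 u.2.
have mh : measurable_fun setT h.
  by apply: measurable_stick_step => //; exact: measurableT_comp.
have -> : stick_chain n.+1 @^-1` D = W @^-1` (h @^-1` D) by [].
by apply: future_freeYB => //; rewrite -[X in measurable X]setTI; exact: mh.
Qed.

Variables alpha beta : probability (measurableTypeR R) R.
Hypothesis lawB : forall k, eq_law (distribution P (B k)) alpha.
Hypothesis lawY : forall k, eq_law (distribution P (Y k)) beta.

(** The transition operator of the chain, acting on functions of the state. *)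
Definition stick_kernel (F : measurableTypeR R * measurableTypeR R -> \bar R) v :=
  (\int[beta]_y \int[alpha]_b F (stick_step v y b))%E.

Lemma stick_kernel_ge0 F v : (forall v, 0 <= F v)%E -> (0 <= stick_kernel F v)%E.
Proof. by move=> F0; apply: integral_ge0 => y _; exact: integral_ge0. Qed.

Section one_step.
Variable F : measurableTypeR R * measurableTypeR R -> \bar R.
Hypotheses (mF : measurable_fun setT F) (F0 : forall v, (0 <= F v)%E).

Let G (u : (measurableTypeR R * measurableTypeR R) *
    measurableTypeR R * measurableTypeR R) :=
  F (stick_step u.1.1 u.1.2 u.2).
Let mG : measurable_fun setT G.
Proof.
apply: measurableT_comp => //; apply: measurable_stick_step => //;
  exact: measurableT_comp.
Qed.

Let mG' := @measurable_fun_fubini_tonelli_F _ _ _ _ R alpha G mG (fun=> F0 _).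

Lemma measurable_stick_kernel : measurable_fun setT (stick_kernel F).
Proof.
apply: (@measurable_fun_fubini_tonelli_F _ _ _ _ R beta (fubini_F alpha G)) => //.
by move=> x; apply: integral_ge0 => y _; exact: F0.
Qed.

Lemma integral_stick_chainS n :
  (\int[P]_w F (stick_chain n.+1 w) = \int[P]_w stick_kernel F (stick_chain n w))%E.
Proof.
have mS := measurable_stick_chain n.
have H := @future_free_all n.
transitivity (\int[P]_w G ((stick_chain n w, Y n w), B n w))%E; first by [].
rewrite (@integral_indep_pair _ _ _ _ _ _ _ P
  (fun w => (stick_chain n w, Y n w)) (B n) _ _ alpha)//; first last.
- by move=> x; exact: F0.
- move=> A C mA mC.
  have e2 : B n @^-1` C = cyl (fun=> C) [:: inl n].
    by rewrite /cyl (@cyl_cons _ _ _ _ _ Z) (@cyl_nil _ _ _ _ _ Z) setIT.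
  by rewrite e2 future_freeY//= leqnn.
- by move=> C mC; exact: lawB.
- exact: measurable_fun_pair.
rewrite (@integral_indep_pair _ _ _ _ _ _ _ P
  (stick_chain n) (Y n) _ _ beta _ _ (fubini_F alpha G))//; first last.
- by move=> x; apply: integral_ge0 => y _; exact: F0.
- move=> A C mA mC.
  have e2 : Y n @^-1` C = cyl (fun=> C) [:: inr n].
    by rewrite /cyl (@cyl_cons _ _ _ _ _ Z) (@cyl_nil _ _ _ _ _ Z) setIT.
  by rewrite e2 H//= leqnn.
- by move=> C mC; exact: lawY.
Qed.

End one_step.

Lemma integral_stick_chain n F :
  measurable_fun setT F -> (forall v, 0 <= F v)%E ->
  (\int[P]_w F (stick_chain n w) = iter n stick_kernel F (0, 1)%R)%E.
Proof.
elim: n F => [|n ih] F mF F0 /=.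
  by rewrite integral_cst// [X in (_ * X)%E](probability_setT P) mule1.
rewrite integral_stick_chainS// ih.
- by rewrite -iterSr.
- exact: measurable_stick_kernel.
- by move=> v; exact: stick_kernel_ge0.
Qed.

(** A chain that breaks the remaining stick of length [v.2], with [v.1] already summed, is the
    affine image of a chain that breaks a fresh stick. *)
Let affine (v u : measurableTypeR R * measurableTypeR R)
  : measurableTypeR R * measurableTypeR R := (v.1 + v.2 * u.1, v.2 * u.2).

(* By this equivariance, the step taken last by the chain can be moved to the
   front, which avoids shifting the sequences B and Y. *)
Lemma iter_stick_kernel_affine n F v u :
  iter n stick_kernel (F \o affine v) u = iter n stick_kernel F (affine v u).
Proof.
elim: n u => [//|n ih] u /=.
apply: eq_integral => y _; apply: eq_integral => b _; rewrite ih; congr (iter _ _ _ _).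
by rewrite /affine /stick_step/=; congr (_, _); ring.
Qed.

(** The fixed point equation at finite level. The first step leads to the state (y b, 1 - y), the
    image of the initial state (0, 1) under [affine], and equivariance turns the remaining n steps
    into a chain started afresh. *)
Lemma integral_stick_seriesS n (f : measurableTypeR R -> \bar R) :
  measurable_fun setT f -> (forall x, 0 <= f x)%E ->
  (\int[P]_w f (stick_chain n.+1 w).1 =
   \int[beta]_y \int[alpha]_b \int[P]_w f (y * b + (1 - y) * (stick_chain n w).1)%R)%E.
Proof.
move=> mf f0.
have mf1 : measurable_fun setT (f \o fst : measurableTypeR R * measurableTypeR R -> _).
  exact: measurableT_comp.
rewrite (@integral_stick_chain n.+1 (f \o fst))/=.
apply: eq_integral => y _; apply: eq_integral => b _.
have -> : stick_step (0, 1) y b = affine (y * b, 1 - y) (0, 1).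
  by rewrite /affine /stick_step/=; congr (_, _); ring.
rewrite -iter_stick_kernel_affine -integral_stick_chain//.
- apply: measurableT_comp => //; apply: measurable_fun_pair.
    by apply: measurable_funD => //; apply: measurable_funM.
  exact: measurable_funM.
- by move=> v; exact: f0.
- exact: mf1.
- by move=> v; exact: f0.
Qed.

End stick_breaking_chain.

(** * The distributional fixed point *)

Section fixed_point.
Context (R : realType).
Implicit Types (alpha nu : probability (measurableTypeR R) R).
Implicit Types (f : measurableTypeR R -> R).

Lemma bmf_int_law d (T : measurableType d) (P : probability T R)
    (X : {RV P >-> measurableTypeR R}) nu f :
  eq_law (distribution P X) nu -> bmf f ->
  \int[P]_w f (X w) = \int[nu]_x f x.
Proof.
move=> lawX bf; have bfX : bmf (f \o X) by exact: bmf_comp.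
apply: EFin_inj; rewrite !EFin_bmf_int//.
rewrite -[LHS](@integral_distribution _ _ _ _ _ P X (EFin \o f)).
- by apply: eq_measure_integral => A mA _; exact: lawX.
- by case: bf => mf _; exact/measurable_EFinP.
- exact: bmf_integrable.
Qed.

Section mixtures.
Context d (T : measurableType d) (P : probability T R).
Variable alpha : probability (measurableTypeR R) R.

(** Boundedness and measurability of all iterated integrals below are read off from this one
    function of three variables, as sections or partial integrals. *)
Let mix (g : T -> measurableTypeR R) f (u : measurableTypeR R * measurableTypeR R * T) :=
  f (u.1.1 * u.1.2 + (1 - u.1.1) * g u.2).

Let bmf_mix g f : measurable_fun setT g -> bmf f -> bmf (mix g f).
Proof.
move=> mg bf.
apply: (@bmf_comp _ _ _ _ _ (fun u : measurableTypeR R * measurableTypeR R * T =>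
  u.1.1 * u.1.2 + (1 - u.1.1) * g u.2)) => //.
have m1 : measurable_fun setT (fun u : measurableTypeR R * measurableTypeR R * T => u.1.1).
  exact: measurableT_comp.
have m2 : measurable_fun setT (fun u : measurableTypeR R * measurableTypeR R * T => u.1.2).
  exact: measurableT_comp.
apply: measurable_funD; first exact: measurable_funM.
apply: measurable_funM; first exact: measurable_funB.
exact: measurableT_comp.
Qed.

Lemma bmf_mix_section (g : T -> measurableTypeR R) f (y b : R) :
  measurable_fun setT g -> bmf f ->
  bmf (fun w => f (y * b + (1 - y) * g w)).
Proof. by move=> mg bf; exact: (bmf_slice1 (bmf_mix mg bf) (y, b)). Qed.

Lemma bmf_mix_int (g : T -> measurableTypeR R) f : measurable_fun setT g -> bmf f ->
  bmf (fun v : measurableTypeR R * measurableTypeR R =>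
    \int[P]_w f (v.1 * v.2 + (1 - v.1) * g w)).
(* Any probability on the pairs would do in place of the product of [alpha] with itself: the
   conclusion does not mention it. *)
Proof. by move=> mg bf; exact: (bmf_int1 (alpha \x alpha)%E P (bmf_mix mg bf)). Qed.

Lemma bmf_mix_int_section (g : T -> measurableTypeR R) f (y : R) :
  measurable_fun setT g -> bmf f ->
  bmf (fun b : measurableTypeR R => \int[P]_w f (y * b + (1 - y) * g w)).
Proof. by move=> mg bf; exact: (bmf_slice1 (bmf_mix_int mg bf) y). Qed.

Lemma bmf_mix_int2 (g : T -> measurableTypeR R) f : measurable_fun setT g -> bmf f ->
  bmf (fun y : measurableTypeR R => \int[alpha]_b \int[P]_w f (y * b + (1 - y) * g w)).
Proof. by move=> mg bf; exact: (bmf_int1 alpha alpha (bmf_mix_int mg bf)). Qed.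

End mixtures.

(** * Passage to the limit along the chain *)

Section chain_limit.
Context d (T : measurableType d) (P : probability T R).
Variables (B Y : nat -> {RV P >-> measurableTypeR R}) (X : {RV P >-> measurableTypeR R}).
Hypothesis Zind : mutually_independent
  (fun i : nat + nat => match i with inl k => B k | inr k => Y k end).
Variables alpha beta nu : probability (measurableTypeR R) R.
Hypothesis lawB : forall k, eq_law (distribution P (B k)) alpha.
Hypothesis lawY : forall k, eq_law (distribution P (Y k)) beta.

Let S n w := (stick_chain B Y n w).1.
Let mS n : measurable_fun setT (S n).
Proof. by apply: measurableT_comp => //; exact: measurable_stick_chain. Qed.

Let chainS_ge0 n f : bmf f -> (forall x, 0 <= f x) ->
  \int[P]_w f (S n.+1 w) = \int[beta]_y \int[alpha]_b \int[P]_w f (y * b + (1 - y) * S n w).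
Proof.
move=> bf f0; have [mf _] := bf; apply: EFin_inj.
have ih := bmf_mix_int2 P alpha (mS n) bf.
rewrite EFin_bmf_int//; last exact: bmf_comp.
rewrite (@integral_stick_seriesS _ _ _ _ _ _ Zind _ _ lawB lawY n (EFin \o f)); last 2 first.
- exact/measurable_EFinP.
- by move=> x; rewrite lee_fin f0.
rewrite EFin_bmf_int//; apply: eq_integral => y _.
rewrite EFin_bmf_int; last exact: bmf_mix_int_section.
by apply: eq_integral => b _; rewrite EFin_bmf_int//; exact: bmf_mix_section.
Qed.

Let chainS n f : bmf f ->
  \int[P]_w f (S n.+1 w) = \int[beta]_y \int[alpha]_b \int[P]_w f (y * b + (1 - y) * S n w).
Proof.
move=> bf; have [_ [M fM]] := bf.
(* Adding the bound [M] reduces to the nonnegative case; the constant passes through all three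
   integrals because they are taken under probabilities. *)
have bfM : bmf (fun x => f x + M) by apply: bmfD => //; exact: bmf_cst.
have fM0 x : 0 <= f x + M.
  by have := fM x; rewrite ler_norml -lerBlDr sub0r => /andP[].
apply: (addIr M).
transitivity (\int[P]_w (f (S n.+1 w) + M)).
  by rewrite bmf_intD ?prob_int_cst//; [exact: bmf_comp|exact: bmf_cst].
rewrite (chainS_ge0 n bfM fM0).
transitivity (\int[beta]_y (\int[alpha]_b \int[P]_w f (y * b + (1 - y) * S n w) + M)).
  apply: eq_Rintegral => y _.
  transitivity (\int[alpha]_b (\int[P]_w f (y * b + (1 - y) * S n w) + M)).
    apply: eq_Rintegral => b _.
    by rewrite bmf_intD ?prob_int_cst//; [exact: bmf_mix_section|exact: bmf_cst].
  by rewrite bmf_intD ?prob_int_cst//; [exact: bmf_mix_int_section|exact: bmf_cst].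
by rewrite bmf_intD ?prob_int_cst//; [exact: bmf_mix_int2|exact: bmf_cst].
Qed.

Hypothesis SX : {ae P, forall w,
          series (fun k => stick_weight (fun j => Y j w) k * B k w) @ \oo
            --> (X w : R)}.
Hypothesis lawX : eq_law (distribution P X) nu.

Let S_cvg (f : R -> R) (a b : R) : continuous f ->
  {ae P, forall w, f (a + b * S n w) @[n --> \oo] --> f (a + b * X w)}.
Proof.
move=> cf; apply: filterS SX => w Sw.
apply: (@cvg_comp _ _ _ (fun n => a + b * S n w) f _ (nbhs (a + b * X w)) _ _ (cf _)).
apply: cvgD; first exact: cvg_cst; apply: cvgM; first exact: cvg_cst.
apply: cvg_trans Sw; apply: near_eq_cvg; apply: nearW => n.
by rewrite /S stick_chainE.
Qed.

(** Let n tend to infinity in [chainS], by dominated convergence: once on the left and at each of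
    the three nested integrals on the right. Continuity of [f] transports the almost sure
    convergence of the series. *)
Lemma stick_fixed_point f : continuous (f : R -> R) -> bmf f ->
  \int[nu]_x f x = \int[beta]_y \int[alpha]_b \int[nu]_x f (y * b + (1 - y) * x).
Proof.
move=> cf bf; have [mf [M fM]] := bf.
have mX : measurable_fun setT X by [].
have lhs : \int[P]_w f (S n.+1 w) @[n --> \oo] --> \int[nu]_x f x.
  rewrite -(bmf_int_law lawX bf).
  apply: (@bmf_dct _ _ _ P (fun n w => f (S n.+1 w)) (fun w => f (X w)) M) => //.
  - by move=> n; exact: measurableT_comp.
  - exact: measurableT_comp.
  - apply: filterS (@S_cvg f 0 1 cf) => w; rewrite mul1r add0r => h.
    have e : (fun n => f (0 + 1 * S n w)) = (fun n => f (S n w)).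
      by apply/funext => n; rewrite mul1r add0r.
    by rewrite (cvg_shiftS (fun n => f (S n w)) (nbhs (f (X w)))) -e.
have rhs : \int[beta]_y \int[alpha]_b \int[P]_w f (y * b + (1 - y) * S n w) @[n --> \oo]
    --> \int[beta]_y \int[alpha]_b \int[P]_w f (y * b + (1 - y) * X w).
  apply: (@bmf_dct _ _ _ beta _ _ M) => //.
  - by move=> n; have [] := bmf_mix_int2 P alpha (mS n) bf.
  - by have [] := bmf_mix_int2 P alpha mX bf.
  - move=> n y; apply: bmf_int_norm; first exact: bmf_mix_int_section.
    by move=> b; apply: bmf_int_norm => //; exact: bmf_mix_section.
  apply: nearW => y; apply: (@bmf_dct _ _ _ alpha _ _ M) => //.
  - by move=> n; have [] := bmf_mix_int_section P alpha y (mS n) bf.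
  - by have [] := bmf_mix_int_section P alpha y mX bf.
  - by move=> n b; apply: bmf_int_norm => //; exact: bmf_mix_section.
  apply: nearW => b; apply: (@bmf_dct _ _ _ P _ _ M) => //.
  - by move=> n; have [] := bmf_mix_section y b (mS n) bf.
  - by have [] := bmf_mix_section y b mX bf.
  exact: S_cvg.
have -> : \int[beta]_y \int[alpha]_b \int[nu]_x f (y * b + (1 - y) * x) =
    \int[beta]_y \int[alpha]_b \int[P]_w f (y * b + (1 - y) * X w).
  apply: eq_Rintegral => y _; apply: eq_Rintegral => b _.
  rewrite (@bmf_int_law _ _ P X nu (fun x => f (y * b + (1 - y) * x)))//.
  apply: (@bmf_comp _ _ _ _ _ (fun x : measurableTypeR R => y * b + (1 - y) * x)) => //.
  by apply: measurable_funD => //; exact: measurable_funM.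
apply: (cvg_unique _ lhs) => //; apply: cvg_trans rhs; apply: near_eq_cvg.
by apply: nearW => n; rewrite chainS.
Qed.

End chain_limit.

Lemma is_mu_fixed_point t alpha nu : is_mu t alpha nu ->
  exists beta : probability (measurableTypeR R) R, eq_law beta (beta1_law t) /\
  forall f, continuous (f : R -> R) -> bmf f ->
  \int[nu]_x f x = \int[beta]_y \int[alpha]_b \int[nu]_x f (y * b + (1 - y) * x).
Proof.
move=> [d [T [P [B [Y [X [ind lawB lawY SX lawX]]]]]]].
(* [beta1_law t] is a mere set function; the law of [Y 0] realizes it as a probability. *)
exists (distribution P (Y 0)); split; first exact: lawY.
move=> f cf bf.
apply: (@stick_fixed_point _ _ _ B Y X) => // k A mA.
by rewrite [LHS](lawY k A mA) [RHS](lawY 0%N A mA).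
Qed.

End fixed_point.

(** * Uniqueness of Laplace transforms on an interval *)

Section expR_bounds.
Context (R : realType).
Implicit Types x : R.

Lemma cvg_series_exp_coeff x : series (exp_coeff x) @ \oo --> expR x.
Proof. exact: is_cvg_series_exp_coeff. Qed.

Lemma series_exp_coeff_le x n : 0 <= x -> series (exp_coeff x) n <= expR x.
Proof.
move=> x0; apply: nondecreasing_cvgn_le; last exact: is_cvg_series_exp_coeff.
by apply: nondecreasing_series => k _ _; exact: exp_coeff_ge0.
Qed.

Lemma norm_series_exp_coeff_le x n : `|series (exp_coeff x) n| <= expR `|x|.
Proof.
apply: le_trans (series_exp_coeff_le n (normr_ge0 x)).
rewrite /series/= (le_trans (ler_norm_sum _ _ _))//.
by apply: ler_sum => k _; rewrite /exp_coeff/= normrM normrX [X in _ * X]ger0_norm.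
Qed.

Lemma exprn_le_expR x n : 0 <= x -> x ^+ n <= n`!%:R * expR x.
Proof.
move=> x0; case: n => [|n].
  by rewrite expr0 fact0 mul1r -[leLHS]expR0 ler_expR.
rewrite mulrC -ler_pdivrMr ?ltr0n ?fact_gt0//.
by apply: le_trans (expR_ge1Dxn n x0); rewrite lerDr.
Qed.

Lemma expR_difference_quotient_dist (h x : R) : 0 < h -> 0 <= x ->
  `|(1 - expR (- (h * x))) / h - x| <= h * x ^+ 2.
Proof.
move=> h0 x0; have hx0 : 0 <= h * x by rewrite mulr_ge0// ltW.
have h1 : 1 - expR (- (h * x)) <= h * x.
  by rewrite lerBlDr -lerBlDl; have := expR_ge1Dx (- (h * x)); lra.
have h2 : h * x - (h * x) ^+ 2 <= 1 - expR (- (h * x)).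
  suff : expR (- (h * x)) <= 1 - h * x + (h * x) ^+ 2 by lra.
  (* With u = h x: (1 - u + u^2) (1 + u) = 1 + u^3 >= 1, and 1 + u <= exp u. *)
  rewrite expRN -[leLHS]mul1r ler_pdivrMr ?expR_gt0//.
  apply: (@le_trans _ _ ((1 - h * x + (h * x) ^+ 2) * (1 + h * x))).
    have -> : (1 - h * x + (h * x) ^+ 2) * (1 + h * x) = 1 + (h * x) ^+ 3 by ring.
    by rewrite lerDl exprn_ge0.
  rewrite ler_pM2l ?expR_ge1Dx//.
  by move: (h * x) => u; have := sqr_ge0 (u - 1); have := sqr_ge0 u; rewrite !expr2; nra.
rewrite distrC ger0_norm ?subr_ge0; last by rewrite ler_pdivrMr// [leRHS]mulrC.
rewrite lerBlDr -lerBlDl ler_pdivlMr//; apply: le_trans h2.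
by rewrite le_eqVlt; apply/orP; left; apply/eqP; ring.
Qed.

Lemma expR_difference_quotient_bound (h x : R) : 0 < h -> 0 <= x ->
  0 <= (1 - expR (- (h * x))) / h <= x.
Proof.
move=> h0 x0; have hx0 : 0 <= h * x by rewrite mulr_ge0// ltW.
apply/andP; split.
  by rewrite divr_ge0 ?(ltW h0)// subr_ge0 expR_le1 oppr_le0.
by rewrite ler_pdivrMr// [leRHS]mulrC; have := expR_ge1Dx (- (h * x)); lra.
Qed.

End expR_bounds.

Section laplace_uniqueness.
Context d (T : measurableType d) (R : realType) (M : probability T R).
Variables (l g : T -> R) (eta : R).
Hypotheses (ml : measurable_fun setT l) (l0 : forall x, 0 <= l x).
Hypothesis bg : bmf g.
Hypothesis eta0 : 0 < eta.
(** This makes the transform th -> E[exp(-th l) g] analytic around every th >= 0, with a radius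
    bounded below independently of th. *)
Hypothesis l_exp : M.-integrable setT (fun x => (expR (eta * l x))%:E).

Let mexp k : measurable_fun setT (fun x => expR (k * l x)).
Proof.
by apply: (@measurableT_comp _ _ _ _ _ _ (@expR R)) => //; exact: measurable_funM.
Qed.

Let int_exp (K : R) : M.-integrable setT (fun x => (K * expR (eta * l x))%:E).
Proof.
apply: (eq_integrable _ (fun x => K%:E * (expR (eta * l x))%:E)%E) => //.
exact: integrableZl.
Qed.

Let int_dom (f : T -> R) (K : R) : measurable_fun setT f ->
  (forall x, `|f x| <= K * expR (eta * l x)) ->
  M.-integrable setT (EFin \o f).
Proof.
move=> mf fK.
apply: (@le_integrable _ _ _ M _ _ _ (fun x => (K * expR (eta * l x))%:E)) => //.
- exact/measurable_EFinP.
- move=> x _ /=; rewrite lee_fin (le_trans (fK x))// ler_norm//.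
Qed.

Let dct_dom (f_ : nat -> T -> R) (f : T -> R) (K : R) :
  (forall n, measurable_fun setT (f_ n)) -> measurable_fun setT f ->
  (forall n x, `|f_ n x| <= K * expR (eta * l x)) ->
  (forall x, f_ n x @[n --> \oo] --> f x) ->
  \int[M]_x f_ n x @[n --> \oo] --> \int[M]_x f x.
Proof.
move=> mf_ mf fK f_f.
have [|||||intf _ h] := @dominated_convergence _ _ _ M setT measurableT
  (fun n => EFin \o f_ n) (EFin \o f) (fun x => (K * expR (eta * l x))%:E).
- by move=> n; exact/measurable_EFinP.
- exact/measurable_EFinP.
- by apply: nearW => x _; apply: cvg_EFin; [exact: nearW|exact: f_f].
- exact: int_exp.
- by apply: nearW => x n _; rewrite /= lee_fin.
- by rewrite /Rintegral; apply: fine_cvg; rewrite fineK//; exact: integrable_fin_num.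
Qed.

Let G := sval (cid bg.2).
Let gG x : `|g x| <= G. Proof. exact: (svalP (cid bg.2) x). Qed.
Let G0 (x : T) : 0 <= G. Proof. exact: le_trans (gG x). Qed.

Let bexp k : 0 <= k -> bmf (fun x => expR (- (k * l x))).
Proof.
move=> k0; split; first by under eq_fun do rewrite -mulNr; exact: mexp.
exists 1 => x; rewrite ger0_norm ?expR_ge0// -expR0 ler_expR oppr_le0.
by rewrite mulr_ge0.
Qed.

Section finite_differences.
Variable eps : R.
Hypothesis eps0 : 0 < eps.
Hypothesis lap0 : forall th, 0 <= th -> th < eps ->
  \int[M]_x (expR (- (th * l x)) * g x) = 0.

(** The integral is, up to sign, the k-th finite difference with step [h] of the transform. It
    involves only the points th + j h with j <= k, all of which lie below [eps]. *)
Let diff0 k h th : 0 < h -> 0 <= th -> th + k%:R * h < eps ->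
  \int[M]_x ((1 - expR (- (h * l x))) ^+ k * (expR (- (th * l x)) * g x)) = 0.
Proof.
move=> h0; have hh := ltW h0; elim: k th => [|k ih] th th0.
  by rewrite mul0r addr0 => the; under eq_Rintegral do rewrite expr0 mul1r; exact: lap0.
move=> the.
have b1 : bmf (fun x => (1 - expR (- (h * l x))) ^+ k).
  by apply: bmfX; apply: bmfB; [exact: bmf_cst|exact: bexp].
transitivity (\int[M]_x ((1 - expR (- (h * l x))) ^+ k * (expR (- (th * l x)) * g x)
  - (1 - expR (- (h * l x))) ^+ k * (expR (- ((th + h) * l x)) * g x))).
  apply: eq_Rintegral => x _; rewrite exprSr mulrDl opprD expRD; ring.
rewrite bmf_intB; last 2 first.
- by apply: bmfM => //; apply: bmfM => //; exact: bexp.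
- by apply: bmfM => //; apply: bmfM => //; apply: bexp; rewrite addr_ge0.
rewrite !ih ?subrr ?addr_ge0//.
- by move: the; rewrite -(natr1 k) mulrDl mul1r; lra.
- by move: the; rewrite -(natr1 k) mulrDl mul1r; lra.
Qed.

(* Take the n-th difference quotient in th at 0 and let its step tend to 0. *)
Lemma moment0_of_laplace0 n : \int[M]_x (l x ^+ n * g x) = 0.
Proof.
(* The factor eps / (n + 1) keeps n h below [eps], as [diff0] requires; the second factor sends the
   step to 0. *)
pose h m := eps / n.+1%:R * m.+1%:R^-1.
have hE m : h m = eps / n.+1%:R * m.+1%:R^-1 by [].
have h0 m : 0 < h m by rewrite hE !mulr_gt0 ?invr_gt0.
clearbody h.
pose f m x := ((1 - expR (- (h m * l x))) / h m) ^+ n * g x.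
have mf m : measurable_fun setT (f m).
  apply: measurable_funM; last by case: bg.
  apply: measurable_funX; apply: measurable_funM => //; apply: measurable_funB => //.
  by under eq_fun do rewrite -mulNr; exact: mexp.
have f0 m : \int[M]_x f m x = 0.
  transitivity (\int[M]_x ((h m)^-1 ^+ n *
      ((1 - expR (- (h m * l x))) ^+ n * (expR (- (0 * l x)) * g x)))).
    by apply: eq_Rintegral => x _; rewrite /f mul0r oppr0 expR0 exprMn; ring.
  rewrite bmf_intZl; last first.
    apply: bmfM; first by apply: bmfX; apply: bmfB; [exact: bmf_cst|exact/bexp/ltW/h0].
    by apply: bmfM => //; exact: bexp.
  rewrite diff0 ?mulr0 ?h0// add0r.
  apply: (@le_lt_trans _ _ (n%:R * (eps / n.+1%:R))).
    by rewrite ler_wpM2l// hE ler_piMr ?divr_ge0 ?(ltW eps0)// invf_le1// ler1n.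
  by rewrite mulrCA gtr_pMr// ltr_pdivrMr// mul1r ltr_nat.
have cvgf : \int[M]_x f m x @[m --> \oo] --> \int[M]_x (l x ^+ n * g x).
  apply: (@dct_dom f _ (n`!%:R / eta ^+ n * G)) => //.
  - apply: measurable_funM; last by case: bg.
    exact: measurable_funX.
  - move=> m x; rewrite /f normrM normrX.
    have /andP[q0 q1] := expR_difference_quotient_bound (h0 m) (l0 x).
    rewrite [leRHS]mulrAC ler_pM ?exprn_ge0//.
    rewrite [X in X ^+ n]ger0_norm// (@le_trans _ _ (l x ^+ n))//.
      by apply: lerXn2r => //; rewrite nnegrE.
    have := @exprn_le_expR R (eta * l x) n (mulr_ge0 (ltW eta0) (l0 x)).
    rewrite exprMn mulrC -ler_pdivlMr ?exprn_gt0// => /le_trans; apply.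
    by rewrite mulrAC.
  - move=> x; apply: cvgM; last exact: cvg_cst.
    apply: (@cvg_comp _ _ _ (fun m => (1 - expR (- (h m * l x))) / h m)
      (fun y => y ^+ n) _ (nbhs (l x))); last exact: exprn_continuous.
    apply/subr_cvg0; apply: norm_cvg0.
    apply: (@squeeze_cvgr _ _ _ _ (fun=> 0) (fun m => h m * l x ^+ 2)).
    + apply: nearW => m; rewrite normr_ge0/=.
      exact: expR_difference_quotient_dist.
    + exact: cvg_cst.
    + rewrite -(mul0r (l x ^+ 2)); apply: cvgM; last exact: cvg_cst.
      have -> : h = (fun m => eps / n.+1%:R * m.+1%:R^-1) by apply/funext.
      rewrite -(mulr0 (eps / n.+1%:R)); apply: cvgM; first exact: cvg_cst.
      exact: cvg_harmonic.
apply/esym; apply: (cvg_unique _ _ cvgf) => //.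
by rewrite (_ : (fun m => _) = fun=> 0); [exact: cvg_cst|apply/funext => m; exact: f0].
Qed.

End finite_differences.

(** Half of [eta], because two factors exp(r l) are spent: one dominates the partial sums of the
    exponential series, the other the power l^n. *)
Let r := eta / 2.
Let r0 : 0 < r. Proof. by rewrite divr_gt0. Qed.

Let pow_bound n x (c : R) : 0 < c -> l x ^+ n <= n`!%:R / c ^+ n * expR (c * l x).
Proof.
move=> c0; have := @exprn_le_expR R (c * l x) n (mulr_ge0 (ltW c0) (l0 x)).
by rewrite exprMn mulrC -ler_pdivlMr ?exprn_gt0// => /le_trans; apply; rewrite mulrAC.
Qed.

Let expN_le1 th x : 0 <= th -> `|expR (- (th * l x))| <= 1.
Proof.
by move=> th0; rewrite ger0_norm ?expR_ge0// -expR0 ler_expR oppr_le0 mulr_ge0.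
Qed.

Let mpow th n : measurable_fun setT (fun x => l x ^+ n * (expR (- (th * l x)) * g x)).
Proof.
apply: measurable_funM; first exact: measurable_funX.
apply: measurable_funM; last by case: bg.
by under eq_fun do rewrite -mulNr; exact: mexp.
Qed.

Let int_pow th n : 0 <= th ->
  M.-integrable setT (EFin \o (fun x => l x ^+ n * (expR (- (th * l x)) * g x))).
Proof.
move=> th0; apply: (int_dom (K := n`!%:R / eta ^+ n * G)) => // x.
rewrite !normrM normrX (ger0_norm (l0 x)) [leRHS]mulrAC ler_pM ?mulr_ge0 ?exprn_ge0//.
  exact: pow_bound.
by rewrite -[leRHS]mul1r ler_pM ?expN_le1.
Qed.

(* Expand expR (- (r * l x)) in its power series; the radius r does not depend on
   th, so this can be iterated. *)
Lemma moment0_shift th : 0 <= th ->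
  (forall n, \int[M]_x (l x ^+ n * (expR (- (th * l x)) * g x)) = 0) ->
  forall n, \int[M]_x (l x ^+ n * (expR (- ((th + r) * l x)) * g x)) = 0.
Proof.
move=> th0 mom n.
pose f N x := series (exp_coeff (- (r * l x))) N * (l x ^+ n * (expR (- (th * l x)) * g x)).
have fS N x : f N.+1 x = f N x +
    (- r) ^+ N / N`!%:R * (l x ^+ (N + n) * (expR (- (th * l x)) * g x)).
  rewrite /f /series/= big_nat_recr//= mulrDl; congr (_ + _).
  by rewrite /exp_coeff/= -mulNr exprMn exprD; ring.
have f00 x : f 0 x = 0 by rewrite /f /series/= big_geq// mul0r.
have intf N : M.-integrable setT (EFin \o f N) /\ \int[M]_x f N x = 0.
  elim: N => [|N [iN sN]].
    have -> : f 0%N = fun=> 0 by apply/funext => x; rewrite f00.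
    split; last by rewrite prob_int_cst.
    by apply: bmf_integrable; exact: bmf_cst.
  have iZ : M.-integrable setT (EFin \o (fun x =>
      (- r) ^+ N / N`!%:R * (l x ^+ (N + n) * (expR (- (th * l x)) * g x)))).
    apply: (eq_integrable _ (fun x => ((- r) ^+ N / N`!%:R)%:E *
      (l x ^+ (N + n) * (expR (- (th * l x)) * g x))%:E)%E) => //.
    by apply: integrableZl => //; exact: int_pow.
  have -> : f N.+1 = (fun x => f N x +
    (- r) ^+ N / N`!%:R * (l x ^+ (N + n) * (expR (- (th * l x)) * g x))).
    by apply/funext => x; exact: fS.
  split; last first.
    rewrite RintegralD// sN add0r RintegralZl//; last exact: int_pow.
    by rewrite mom mulr0.
  exact: (integrableD measurableT iN iZ).
have cvgf : \int[M]_x f N x @[N --> \oo] -->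
    \int[M]_x (l x ^+ n * (expR (- ((th + r) * l x)) * g x)).
  apply: (@dct_dom f _ (n`!%:R / r ^+ n * G)) => //.
  - by move=> N; have [/integrableP[/measurable_EFinP]] := intf N.
  - move=> N x; rewrite /f !normrM normrX (ger0_norm (l0 x)).
    apply: (@le_trans _ _ (expR (r * l x) * (n`!%:R / r ^+ n * expR (r * l x) * (1 * G)))).
      apply: ler_pM; rewrite ?mulr_ge0 ?exprn_ge0//.
        rewrite (le_trans (norm_series_exp_coeff_le _ _))// normrN ger0_norm//.
        by rewrite mulr_ge0 ?(ltW r0).
      apply: ler_pM; rewrite ?mulr_ge0 ?exprn_ge0//; first exact: pow_bound.
      by apply: ler_pM; rewrite ?expN_le1.
    have -> : eta * l x = r * l x + r * l x by rewrite /r; field.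
    by rewrite expRD le_eqVlt; apply/orP; left; apply/eqP; ring.
  - move=> x; have -> : l x ^+ n * (expR (- ((th + r) * l x)) * g x) =
       expR (- (r * l x)) * (l x ^+ n * (expR (- (th * l x)) * g x)).
      by rewrite mulrDl opprD expRD; ring.
    by apply: cvgM; [exact: cvg_series_exp_coeff|exact: cvg_cst].
apply/esym; apply: (cvg_unique _ _ cvgf) => //.
rewrite (_ : (fun N => _) = fun=> 0); first exact: cvg_cst.
by apply/funext => N; case: (intf N).
Qed.

(** All moments vanish at th = 0, and each shift by [r] preserves this, so they vanish at th = k r
    for every k, far outside the interval of the hypothesis. The claim is the moment of order 0; the
    others are needed to iterate. *)
Lemma laplace0_powers eps : 0 < eps ->
  (forall th, 0 <= th -> th < eps -> \int[M]_x (expR (- (th * l x)) * g x) = 0) ->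
  forall k, \int[M]_x (expR (- (r * l x)) ^+ k * g x) = 0.
Proof.
move=> eps0 lap0 k.
suff H : forall n, \int[M]_x (l x ^+ n * (expR (- (k%:R * r * l x)) * g x)) = 0.
  rewrite -[RHS](H 0%N); apply: eq_Rintegral => x _.
  by rewrite expr0 mul1r -expRM_natl mulrN mulrA.
elim: k => [|k ih] n.
  rewrite -[RHS](moment0_of_laplace0 eps0 lap0 n); apply: eq_Rintegral => x _.
  by rewrite !mul0r oppr0 expR0 mul1r.
rewrite -natr1 mulrDl mul1r; apply: moment0_shift => //.
by rewrite mulr_ge0// ltW.
Qed.

End laplace_uniqueness.

(** * Vanishing power moments exclude a local sign *)

Section concentration.
Context d (T : measurableType d) (R : realType) (M : probability T R).
Variables (t g : T -> R).
Hypotheses (mt : measurable_fun setT t) (t01 : forall x, 0 <= t x <= 1).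
Hypothesis bg : bmf g.
Hypothesis pow0 : forall k, \int[M]_x (t x ^+ k * g x) = 0.

Let bt : bmf t.
Proof.
by split => //; exists 1 => x; have /andP[? ?] := t01 x; rewrite ger0_norm.
Qed.

Let poly0 (p : {poly R}) : bmf (fun x => p.[t x]) /\ \int[M]_x (p.[t x] * g x) = 0.
Proof.
(* The additional factor t^k makes the induction along Horner's scheme go through. *)
suff H : forall s : seq R, bmf (fun x => (Poly s).[t x]) /\
    forall k, \int[M]_x ((Poly s).[t x] * (t x ^+ k * g x)) = 0.
  have [b0 h0] := H p; rewrite polyseqK in b0 h0; split => //.
  by rewrite -[RHS](h0 0%N); apply: eq_Rintegral => x _; rewrite expr0 mul1r.
elim=> [|a s [bs ih]] /=.
  split; first by under eq_fun do rewrite horner0; exact: bmf_cst.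
  by move=> k; under eq_Rintegral do rewrite horner0 mul0r; rewrite prob_int_cst.
split.
  by under eq_fun do rewrite horner_cons; apply: bmfD; [exact: bmfM|exact: bmf_cst].
move=> k; have bk : bmf (fun x => t x ^+ k * g x) by apply: bmfM => //; exact: bmfX.
transitivity (\int[M]_x ((Poly s).[t x] * (t x ^+ k.+1 * g x) + a * (t x ^+ k * g x))).
  by apply: eq_Rintegral => x _; rewrite horner_cons exprS; ring.
rewrite bmf_intD ?ih ?bmf_intZl ?pow0 ?mulr0 ?addr0//.
- by apply: bmfM => //; apply: bmfM => //; exact: bmfX.
- by apply: bmfM => //; exact: bmf_cst.
Qed.

(* The kernels ((1 - (t - t0)^2) / (1 - del^2 / 4))^n are polynomials in t that
   are at least 1 near t0 and tend to 0 uniformly away from it. *)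
Lemma powers0_local_sign t0 del e : 0 <= t0 <= 1 -> 0 < del -> del < 1 -> 0 < e ->
  (forall x, `|t x - t0| <= del -> e <= g x) ->
  M [set x | `|t x - t0| <= del / 2] = 0.
Proof.
move=> /andP[t00 t0le1] del0 del1 e0 ge.
set A := [set x | `|t x - t0| <= del / 2].
have mA : measurable A.
  have -> : A = (fun x => `|t x - t0|) @^-1` `]-oo, del / 2]%classic.
    by apply/seteqP; split => x /=; rewrite in_itv.
  rewrite -[X in measurable X]setTI.
  have mm : measurable_fun setT (fun x => `|t x - t0|).
    by apply: measurableT_comp => //; exact: measurable_funB.
  by apply: mm => //; exact: measurable_itv.
have [_ [G gG]] := bg.
pose q := 1 - del ^+ 2 / 4.
(* The base of the kernel at distance [del] from [t0], hence an upper bound for it farther away. *)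
pose rho := (1 - del ^+ 2) / q.
have q0 : 0 < q by rewrite /q; nra.
have rho0 : 0 <= rho by rewrite divr_ge0 ?(ltW q0)//; nra.
have rho1 : rho < 1 by rewrite ltr_pdivrMr// mul1r /q; nra.
pose p n := ((1 - ('X - t0%:P) ^+ 2) * (q^-1)%:P) ^+ n : {poly R}.
have pE n x : (p n).[t x] = ((1 - (t x - t0) ^+ 2) / q) ^+ n.
  by rewrite /p !hornerE.
have b1A : bmf (\1_A : T -> R).
  split; first exact: measurable_indic.
  by exists 1 => x; rewrite indicE; case: (_ \in _); rewrite ?normr1 ?normr0.
(* The integral of kernel times [g] is 0. The integrand is at least [e] on [A], nonnegative at
   distances between del / 2 and [del], and at least - G rho^n beyond [del]. *)
have key n : e * \int[M]_x \1_A x <= G * rho ^+ n.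
  have [bp ip] := poly0 (p n).
  rewrite -bmf_intZl// -(prob_int_cst M (G * rho ^+ n)) -subr_le0 -ip -bmf_intB; last 2 first.
  - by apply: bmfM => //; exact: bmf_cst.
  - exact: bmf_cst.
  apply: bmf_le_int => [|| x].
  - apply: bmfB; last exact: bmf_cst.
    by apply: bmfM => //; exact: bmf_cst.
  - exact: bmfM.
  rewrite pE; have G0 : 0 <= G by apply: le_trans (gG x).
  have Gr : 0 <= G * rho ^+ n by rewrite mulr_ge0// exprn_ge0.
  have /andP[tx0 tx1] := t01 x.
  have u2 : (t x - t0) ^+ 2 = `|t x - t0| ^+ 2 by rewrite real_normK// num_real.
  have u0 := normr_ge0 (t x - t0).
  have u1 : `|t x - t0| <= 1 by rewrite ler_norml; lra.
  rewrite u2; move: u0 u1 (ge x); rewrite -/A indicE.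
  have -> : (x \in A) = (`|t x - t0| <= del / 2) by apply/idP/idP; rewrite inE.
  move: (`|_ - _|) => u u0 u1 gex.
  have K0 : 0 <= (1 - u ^+ 2) / q by rewrite divr_ge0 ?(ltW q0)//; nra.
  have [uA|uA] := leP u (del / 2).
    have K1 : 1 <= (1 - u ^+ 2) / q by rewrite ler_pdivlMr// mul1r /q; nra.
    have Kn1 : 1 <= ((1 - u ^+ 2) / q) ^+ n by exact: exprn_ege1.
    have eg : e <= g x by apply: gex; lra.
    rewrite mulr1; nra.
  rewrite mulr0 sub0r.
  have [ud|ud] := leP u del.
    by rewrite (@le_trans _ _ 0) ?oppr_le0// mulr_ge0 ?exprn_ge0// (le_trans (ltW e0))// gex.
  have Kr : (1 - u ^+ 2) / q <= rho.
    by rewrite ler_pM2r ?invr_gt0//; nra.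
  have Krn : ((1 - u ^+ 2) / q) ^+ n <= rho ^+ n by rewrite lerXn2r.
  have := gG x; rewrite ler_norml => /andP[g1 g2].
  have Kn0 : 0 <= ((1 - u ^+ 2) / q) ^+ n by exact: exprn_ge0.
  nra.
have iA : \int[M]_x \1_A x = fine (M A) by rewrite /Rintegral integral_indic// setIT.
have MA0 : 0 <= fine (M A) by exact: fine_ge0.
have cr : G * rho ^+ n @[n --> \oo] --> 0.
  rewrite -(mulr0 G); apply: cvgM; first exact: cvg_cst.
  by apply: cvg_expr; rewrite ger0_norm.
have : e * fine (M A) <= 0.
  rewrite -(cvg_lim (@Rhausdorff R) cr); apply: limr_ge; first by apply/cvg_ex; exists 0.
  by apply: nearW => n; rewrite -iA.
rewrite pmulr_rle0// => MA.
apply/eqP; rewrite -(@fineK _ (M A)) ?fin_num_measure// eqe.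
by rewrite eq_le MA MA0.
Qed.

End concentration.

(** * The laws beta(1, a) *)

Section integral_density.
Context d (T : measurableType d) (R : realType).
Variables (m mu : {measure set T -> \bar R}) (f : T -> R).
Hypotheses (mf : measurable_fun setT f) (f0 : forall x, 0 <= f x).
Hypothesis mE : forall A, measurable A -> m A = (\int[mu]_(x in A) (f x)%:E)%E.

Import HBNNSimple.

Let integral_density_indic A : measurable A ->
  (\int[m]_x (\1_A x)%:E = \int[mu]_x ((\1_A x)%:E * (f x)%:E))%E.
Proof.
move=> mA; rewrite integral_indic// setIT mE// [LHS]integral_mkcond.
apply: eq_integral => x _; rewrite patchE indicE; case: ifPn => xA; first by rewrite mul1e.
by rewrite mul0e.
Qed.

Let integral_density_nnsfun (s : {nnsfun T >-> R}) :
  (\int[m]_x (s x)%:E = \int[mu]_x ((s x)%:E * (f x)%:E))%E.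
Proof.
under [LHS]eq_integral do rewrite fimfunE -fsumEFin//.
rewrite [LHS]ge0_integral_fsum//; last 2 first.
  - by move=> r; exact/measurable_EFinP/measurableT_comp.
  - by move=> n x _; rewrite EFinM nnfun_muleindic_ge0.
under [RHS]eq_integral.
  move=> x _; rewrite fimfunE -fsumEFin// ge0_mule_fsuml; last first.
    by move=> r; rewrite EFinM nnfun_muleindic_ge0.
  over.
rewrite [RHS]ge0_integral_fsum//; last 2 first.
  - move=> r; apply: emeasurable_funM; last exact/measurable_EFinP.
    by apply/measurable_EFinP; exact: measurableT_comp.
  - move=> n x _; rewrite EFinM mule_ge0//; first by rewrite nnfun_muleindic_ge0.
    by rewrite lee_fin.
apply: eq_fsbigr => r rs.
have r0 : 0 <= r by move: rs; rewrite inE => -[x _ <-].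
under eq_integral do rewrite EFinM.
rewrite ge0_integralZl//; last first.
  by apply/measurable_EFinP; exact: measurable_indic.
rewrite integral_density_indic//.
under [RHS]eq_integral do rewrite EFinM -muleA.
rewrite ge0_integralZl//.
- apply: emeasurable_funM; last exact/measurable_EFinP.
  by apply/measurable_EFinP; exact: measurable_indic.
- by move=> x _; rewrite mule_ge0// lee_fin.
Qed.

Lemma integral_density (h : T -> \bar R) :
  measurable_fun setT h -> (forall x, 0 <= h x)%E ->
  (\int[m]_x h x = \int[mu]_x (h x * (f x)%:E))%E.
Proof.
move=> mh h0; pose h_ := nnsfun_approx measurableT mh.
have hcvg x : (h_ n x)%:E @[n --> \oo] --> h x by exact: cvg_nnsfun_approx.
have hnd x a b : (a <= b)%N -> h_ a x <= h_ b x.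
  by move=> ab; exact/lefP/nd_nnsfun_approx.
transitivity (lim (\int[m]_x (h_ n x)%:E @[n --> \oo])%E).
  rewrite -monotone_convergence//=.
  - by apply: eq_integral => x _; apply/esym/cvg_lim.
  - by move=> n; exact/measurable_EFinP/measurable_funTS.
  - by move=> n ? _; rewrite lee_fin.
  - by move=> ? _ ? ? mn; rewrite lee_fin; exact: hnd.
transitivity (lim (\int[mu]_x ((h_ n x)%:E * (f x)%:E) @[n --> \oo])%E).
  by apply: congr_lim; apply/funext => n; exact: integral_density_nnsfun.
rewrite -monotone_convergence//=.
- apply: eq_integral => x _; apply/cvg_lim => //.
  by apply: cvgeZr.
- move=> n; apply: emeasurable_funM; last exact/measurable_EFinP.
  exact/measurable_EFinP/measurable_funTS.
- by move=> n ? _; rewrite -EFinM lee_fin mulr_ge0.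
- by move=> ? _ ? ? mn; rewrite -!EFinM lee_fin ler_wpM2r//; exact: hnd.
Qed.

End integral_density.

Section beta_laws.
Context (R : realType).
Implicit Types (y a : R).

Definition beta1_density a (y : measurableTypeR R) : R :=
  \1_(`]0%R, 1%R[%classic : set (measurableTypeR R)) y * (a * (1 - y) `^ (a - 1)).

(* Equal to -ln (1 - y) on ]0, 1[ and to 0 elsewhere. *)
Definition mlog (y : measurableTypeR R) : R := Num.max 0 (- ln (1 - y)).

Lemma measurable_mlog : measurable_fun setT mlog.
Proof.
apply: measurable_maxr => //; apply: measurableT_comp => //.
by apply: measurableT_comp; [exact: measurable_ln|exact: measurable_funB].
Qed.

Lemma mlog_ge0 y : 0 <= mlog y. Proof. by rewrite /mlog le_max lexx. Qed.

Lemma mlogE y : 0 < y -> y < 1 -> mlog y = - ln (1 - y).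
Proof.
move=> y0 y1; rewrite /mlog; apply/max_r; rewrite oppr_ge0 ln_le0//; lra.
Qed.

Lemma mlog_out y : ~~ (0 < y < 1) -> mlog y = 0.
Proof.
rewrite negb_and -!leNgt => h; apply/max_l; rewrite oppr_le0.
case/orP: h => h; first by rewrite ln_ge0//; lra.
by rewrite ln0//; lra.
Qed.

Lemma beta1_density_ge0 a y : 0 < a -> 0 <= beta1_density a y.
Proof. by move=> a0; rewrite /beta1_density !mulr_ge0 ?powR_ge0 ?(ltW a0)// indicE. Qed.

Lemma measurable_beta1_density a : measurable_fun setT (beta1_density a).
Proof.
apply: measurable_funM; first by apply: measurable_indic; exact: measurable_itv.
apply: measurable_funM => //.
apply: (@measurableT_comp _ _ _ _ _ _ (fun x : R => x `^ (a - 1))).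
  exact: measurable_powR.
exact: measurable_funB.
Qed.

Lemma beta1_lawE a (A : set (measurableTypeR R)) :
  beta1_law a A = (\int[lebesgue_measure]_(y in A) (beta1_density a y)%:E)%E.
Proof.
rewrite /beta1_law integral_mkcondr; apply: eq_integral => y _.
rewrite patchE /beta1_density indicE; case: (boolP (_ \in _)) => _; first by rewrite mul1r.
by rewrite mul0r.
Qed.

(** The laws beta(1, a) form an exponential family with statistic [mlog]: this is what turns the
    Mellin transform in 1 - y into a Laplace transform. *)
Lemma beta1_densityM a a0 y : 0 < a0 -> beta1_density a y =
  a / a0 * expR (- ((a - a0) * mlog y)) * beta1_density a0 y.
Proof.
move=> a00; rewrite /beta1_density indicE; case: (boolP (_ \in _)) => yi;
  last by rewrite /= !mul0r mulr0.
move: yi; rewrite inE/= in_itv/= => /andP[y0 y1]; rewrite !mul1r mlogE// mulrN opprK.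
have y1' : 0 < 1 - y by lra.
have -> : expR ((a - a0) * ln (1 - y)) = (1 - y) `^ (a - a0).
  by rewrite /powR gt_eqF.
have -> : a - 1 = (a - a0) + (a0 - 1) by ring.
rewrite powRD; last by apply/implyP => _; rewrite gt_eqF.
by field; rewrite gt_eqF.
Qed.

(** If the mass were 0, the density would vanish almost everywhere on an interval of positive length
    on which it is positive. *)
Lemma beta1_law_open (M : probability (measurableTypeR R) R) a (u v : R) : 0 < a ->
  eq_law M (beta1_law a) -> 0 <= u -> u < v -> v <= 1 -> M `]u, v[%classic != 0%E.
Proof.
move=> a0 lawM u0 uv v1; apply/eqP; rewrite lawM; last exact: measurable_itv.
rewrite beta1_lawE => I0.
have : (\int[lebesgue_measure]_(y in `]u, v[%classic) `|(beta1_density a y)%:E| = 0)%E.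
  by rewrite -[RHS]I0; apply: eq_integral => y _; rewrite gee0_abs// lee_fin beta1_density_ge0.
have mD : measurable (`]u, v[%classic : set (measurableTypeR R)) by exact: measurable_itv.
have mfd : measurable_fun `]u, v[%classic (EFin \o beta1_density a).
  by apply/measurable_EFinP/measurable_funTS; exact: measurable_beta1_density.
have [H _] := @ae_eq_integral_abs _ _ _ lebesgue_measure _ mD _ mfd.
case/H => N [mN N0 sN].
have : (lebesgue_measure `]u, v[%classic <= lebesgue_measure N)%E.
  apply: le_measure; rewrite ?inE//.
  move=> y yuv; apply: sN => /= /(_ yuv) /eqP; apply/negP.
  move: yuv; rewrite /= in_itv/= => /andP[uy yv].
  rewrite eqe /beta1_density gt_eqF// mulr_gt0//.
    by rewrite indicE mem_set//= in_itv/=; apply/andP; split; lra.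
  by rewrite mulr_gt0// powR_gt0//; lra.
by rewrite N0 lebesgue_measure_itv/= lte_fin uv -EFinD lee_fin; lra.
Qed.

Lemma beta1_law_change (M0 M : probability (measurableTypeR R) R) a0 a
    (h : measurableTypeR R -> R) :
  0 < a0 -> 0 < a -> eq_law M0 (beta1_law a0) -> eq_law M (beta1_law a) ->
  measurable_fun setT h -> (forall x, 0 <= h x) ->
  (\int[M]_y (h y)%:E =
   \int[M0]_y (a / a0 * (expR (- ((a - a0) * mlog y)) * h y))%:E)%E.
Proof.
move=> a00 aa lawM0 lawM mh h0.
have me : measurable_fun setT (fun y => expR (- ((a - a0) * mlog y))).
  apply: measurableT_comp => //; apply: measurableT_comp => //.
  by apply: measurable_funM => //; exact: measurable_mlog.
rewrite (@integral_density _ _ _ M lebesgue_measure (beta1_density a)); last 5 first.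
- exact: measurable_beta1_density.
- by move=> x; exact: beta1_density_ge0.
- by move=> A mA; rewrite -beta1_lawE; exact: lawM.
- exact/measurable_EFinP.
- by move=> x; rewrite lee_fin.
rewrite (@integral_density _ _ _ M0 lebesgue_measure (beta1_density a0)); last 5 first.
- exact: measurable_beta1_density.
- by move=> x; exact: beta1_density_ge0.
- by move=> A mA; rewrite -beta1_lawE; exact: lawM0.
- apply/measurable_EFinP; apply: measurable_funM => //; exact: measurable_funM.
- by move=> x; rewrite lee_fin !mulr_ge0 ?expR_ge0 ?invr_ge0// ltW.
apply: eq_integral => y _; rewrite -!EFinM (beta1_densityM a y a00); congr (_%:E); ring.
Qed.

End beta_laws.

(** * Uniqueness for mixtures over beta(1, a) *)

Section beta_mixtures.
Context (R : realType).

Lemma bmf_expN_mlog (th : R) : 0 <= th ->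
  bmf (fun y : measurableTypeR R => expR (- (th * mlog y))).
Proof.
move=> th0; split.
  apply: measurableT_comp => //; apply: measurableT_comp => //.
  by apply: measurable_funM => //; exact: measurable_mlog.
exists 1 => y; rewrite ger0_norm ?expR_ge0// -expR0 ler_expR oppr_le0.
by rewrite mulr_ge0 ?mlog_ge0.
Qed.

Lemma beta1_law_Rchange (M0 M : probability (measurableTypeR R) R) (a0 th : R)
    (h : measurableTypeR R -> R) :
  0 < a0 -> 0 <= th -> eq_law M0 (beta1_law a0) -> eq_law M (beta1_law (a0 + th)) ->
  bmf h -> \int[M]_y h y =
    (a0 + th) / a0 * \int[M0]_y (expR (- (th * mlog y)) * h y).
Proof.
move=> a00 th0 lawM0 lawM.
have be := bmf_expN_mlog th0.
have pos k : bmf k -> (forall y, 0 <= k y) -> \int[M]_y k y =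
    (a0 + th) / a0 * \int[M0]_y (expR (- (th * mlog y)) * k y).
  move=> bk k0; have [mk _] := bk; rewrite -bmf_intZl; last exact: bmfM.
  have a1 : 0 < a0 + th by lra.
  rewrite /Rintegral; congr fine; rewrite (beta1_law_change a00 a1 lawM0 lawM mk k0).
  by apply: eq_integral => y _; rewrite [a0 + th - a0]addrAC subrr add0r.
move=> bh; have [_ [G hG]] := bh.
have b1 : bmf (fun _ : measurableTypeR R => 1 : R) by exact: bmf_cst.
have bG : bmf (fun _ : measurableTypeR R => G) by exact: bmf_cst.
(* The case of the constant 1 gives the normalization of the tilt, which cancels the shift by [G]
   used to reach bounded functions of any sign. *)
have e1 := pos _ b1 (fun=> ler01).
have e2 : \int[M]_y (h y + G) = (a0 + th) / a0 *
    \int[M0]_y (expR (- (th * mlog y)) * (h y + G)).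
  apply: pos; first exact: bmfD.
  by move=> y; have := hG y; rewrite ler_norml; lra.
move: e2; under [in RHS]eq_Rintegral do rewrite mulrDr.
rewrite !bmf_intD//; [|exact: bmfM..]; rewrite bmf_intZr//.
move: e1; under [in RHS]eq_Rintegral do rewrite mulr1.
by rewrite !prob_int_cst => e1 e2; apply: (addIr G); rewrite e2 mulrDr mulrA -e1 mul1r.
Qed.

Variables (b c C : R) (Phi : measurableTypeR R -> R).
Hypotheses (b0 : 0 <= b) (bc : b < c).
Hypothesis mix : forall a, b < a -> a < c ->
  exists M : probability (measurableTypeR R) R,
    eq_law M (beta1_law a) /\ \int[M]_y Phi y = C.
Hypotheses (bPhi : bmf Phi) (cPhi : continuous (Phi : R -> R)).

(** If g y > 0, then [g] stays above g y / 2 near y. All power moments of [g] in t = exp(-r mlog)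
    vanish, so [powers0_local_sign] makes a neighbourhood of y a null set, contrary to
    [beta1_law_open]. *)
Let nonpos (g : measurableTypeR R -> R) (y : R) : bmf g -> continuous (g : R -> R) ->
  (forall a, b < a -> a < c ->
    exists M : probability (measurableTypeR R) R,
    eq_law M (beta1_law a) /\ \int[M]_y g y = 0) ->
  0 < y -> y < 1 -> g y <= 0.
Proof.
have [b0' bc'] := conj b0 bc.
move=> bg cg mixg y0 y1; rewrite leNgt; apply/negP => gy0.
(* Both a0 and a0 - eta lie in ]b, c[; the latter law provides the exponential moment of order [eta]
   under the former. *)
pose a0 := (b + c) / 2; pose eta := (a0 - b) / 2.
have ba0 : b < a0 by rewrite /a0; lra.
have a0c : a0 < c by rewrite /a0; lra.
have a00 : 0 < a0 by lra.
have eta0 : 0 < eta by rewrite /eta; lra.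
have [M [lawM intM]] := mixg _ ba0 a0c.
have etaE : eta = (a0 - b) / 2 by [].
clearbody a0 eta.
have [baeta aetac aeta] : [/\ b < a0 - eta, a0 - eta < c & 0 < a0 - eta] by split; lra.
have [M' [lawM' _]] := mixg _ baeta aetac.
have l_exp : M.-integrable setT (fun x => (expR (eta * mlog x))%:E).
  have mexp : measurable_fun setT (fun x : measurableTypeR R => expR (eta * mlog x)).
    apply: (@measurableT_comp _ _ _ _ _ _ (@expR R)) => //.
    by apply: measurable_funM => //; exact: measurable_mlog.
  apply/integrableP; split; first exact/measurable_EFinP.
  have m1 : measurable_fun setT (fun _ : measurableTypeR R => 1 : R) by [].
  (* The total mass 1 of beta(1, a0 - eta) is a positive multiple of the integral of exp(eta mlog)
     under beta(1, a0), which is therefore finite. *)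
  have := beta1_law_change a00 aeta lawM lawM' m1 (fun=> ler01).
  rewrite integral_cst// [X in (_ * X)%E](probability_setT M') mule1.
  have k0 : 0 < (a0 - eta) / a0 by rewrite divr_gt0.
  rewrite (eq_integral (fun y => ((a0 - eta) / a0)%:E * (expR (eta * mlog y))%:E)%E); last first.
    by move=> x _; rewrite -EFinM mulr1; congr (_ * expR _)%:E; ring.
  have mexp' : measurable_fun setT (fun x : measurableTypeR R => (expR (eta * mlog x))%:E).
    exact/measurable_EFinP.
  have e0 (x : measurableTypeR R) : setT x -> (0 <= (expR (eta * mlog x))%:E)%E.
    by move=> _; rewrite lee_fin expR_ge0.
  have k0' : (0 <= ((a0 - eta) / a0)%:E)%E by rewrite lee_fin ltW.
  rewrite (ge0_integralZl M measurableT mexp' e0 k0') => H.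
  under eq_integral do rewrite gee0_abs ?lee_fin ?expR_ge0//.
  move: H; case: (\int[M]_x _)%E => [x _|/esym|]; rewrite ?ltry//.
  by rewrite mulry gtr0_sg// mul1e.
have eps0 : 0 < c - a0 by lra.
have lap th : 0 <= th -> th < c - a0 ->
    \int[M]_x (expR (- (th * mlog x)) * g x) = 0.
  move=> th0 thc; have [M2 [law2 int2]] := mixg (a0 + th) ltac:(lra) ltac:(lra).
  have := beta1_law_Rchange a00 th0 lawM law2 bg.
  rewrite int2 => /esym/eqP; rewrite mulf_eq0 => /orP[|/eqP//].
  by rewrite gt_eqF// divr_gt0//; lra.
pose r := eta / 2.
have r0 : 0 < r by rewrite /r; lra.
have pow0 := laplace0_powers (@measurable_mlog R) (@mlog_ge0 R) bg eta0 l_exp eps0 lap.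
rewrite -/r in pow0.
clear mixg lap l_exp lawM' intM; clearbody r.
pose t (x : measurableTypeR R) := expR (- (r * mlog x)).
have t01 x : 0 <= t x <= 1.
  by rewrite expR_ge0/= /t -expR0 ler_expR oppr_le0 mulr_ge0 ?mlog_ge0// ltW.
have tE (x : R) : 0 < x -> x < 1 -> t x = expR (r * ln (1 - x)).
  by move=> x0 x1; rewrite /t mlogE// mulrN opprK.
pose t0 := t y; have t0E : t0 = t y by [].
have t00 : 0 < t0 by exact: expR_gt0.
have t01' : t0 < 1.
  rewrite /t0 tE// -[ltRHS]expR0 ltr_expR pmulr_rlt0// ln_lt0//.
  by apply/andP; split; lra.
clearbody t0.
(* On ]0, 1[ one has t x = (1 - x)^r, with inverse s -> 1 - s^(1/r); closeness of t x to t y thus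
   controls g x. *)
pose inv (s : R) := 1 - expR (ln s / r).
have invK (x : R) : 0 < x -> x < 1 -> inv (t x) = x.
  move=> x0 x1; rewrite /inv tE// expRK mulrAC divff ?gt_eqF// mul1r lnK ?posrE; first ring.
  by rewrite subr_gt0.
have cinv : g (inv s) @[s --> t0] --> g y.
  rewrite -(invK _ y0 y1) -t0E.
  apply: (@cvg_comp _ _ _ inv g _ (nbhs (inv t0))); last exact: cg.
  apply: cvgB; first exact: cvg_cst.
  apply: (@cvg_comp _ _ _ (fun s => ln s / r) (@expR R) _ (nbhs (ln t0 / r)));
    last exact: continuous_expR.
  by apply: cvgM; [exact: continuous_ln|exact: cvg_cst].
have [d1 /= d10 Hd1] : \forall s \near t0, g y / 2 < g (inv s).
  by apply: (cvgr_gt _ cinv); lra.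
(* The bound (1 - t0) / 2 keeps t x below 1, the value of [t] outside ]0,
   1[, and so forces x into ]0, 1[. *)
pose del := Num.min (d1 / 2) (Num.min (t0 / 2) ((1 - t0) / 2)).
have del0 : 0 < del by rewrite /del !lt_min; apply/and3P; split; lra.
have deld : del <= d1 / 2 by rewrite /del ge_min lexx.
have delt : del <= t0 / 2 by rewrite /del !ge_min lexx orbT.
have delt' : del <= (1 - t0) / 2 by rewrite /del !ge_min lexx !orbT.
clearbody del.
have ge (x : R) : `|t x - t0| <= del -> g y / 2 <= g x.
  move=> xd; have tx1 : t x < 1 by move: xd; rewrite ler_norml; lra.
  have /andP[x0 x1] : 0 < x < 1.
    apply/negPn/negP => /mlog_out xo; move: tx1.
    by rewrite /t xo mulr0 oppr0 expR0 ltxx.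
  rewrite -(invK x x0 x1); apply/ltW/Hd1; rewrite /ball/= distrC.
  by apply: le_lt_trans xd _; lra.
have gy2 : 0 < g y / 2 by lra.
have mt : measurable_fun setT t by case: (bmf_expN_mlog (ltW r0)).
have t0i : 0 <= t0 <= 1 by apply/andP; split; lra.
have del1 : del < 1 by lra.
have MA := powers0_local_sign mt t01 bg pow0 t0i del0 del1 gy2 ge.
have ct : expR (r * ln (1 - s)) @[s --> y] --> expR (r * ln (1 - y)).
  apply: (@cvg_comp _ _ _ (fun s => r * ln (1 - s)) (@expR R) _ (nbhs (r * ln (1 - y))));
    last exact: continuous_expR.
  apply: cvgM; first exact: cvg_cst.
  apply: (@cvg_comp _ _ _ (fun s => 1 - s) (@ln R) _ (nbhs (1 - y))).
    by apply: cvgB; [exact: cvg_cst|exact: cvg_id].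
  by apply: continuous_ln; lra.
have [d2 /= d20 Hd2] : \forall s \near y,
    `|expR (r * ln (1 - y)) - expR (r * ln (1 - s))| < del / 2.
  by have /cvgrPdist_lt := ct; apply; lra.
(* ]y, v[ is contained in the null set just found. *)
pose v := Num.min (y + d2) 1.
have yv : y < v by rewrite /v lt_min; apply/andP; split; lra.
have v1 : v <= 1 by rewrite /v ge_min lexx orbT.
have vd : v <= y + d2 by rewrite /v ge_min lexx.
clearbody v.
have /eqP := beta1_law_open a00 lawM (ltW y0) yv v1; apply.
apply/eqP; rewrite -measure_le0 -MA; apply: le_measure.
- by rewrite inE; exact: measurable_itv.
- rewrite inE -[X in measurable X]setTI.
  have mm : measurable_fun setT (fun x => `|t x - t0|).
    by apply: measurableT_comp => //; exact: measurable_funB.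
  rewrite (_ : [set x | _] = (fun x => `|t x - t0|) @^-1` `]-oo, del / 2]%classic).
    by apply: mm => //; exact: measurable_itv.
  by apply/seteqP; split => x /=; rewrite in_itv.
move=> s /=; rewrite in_itv/= => /andP[us sv].
have s0 : 0 < s by exact: lt_trans us.
rewrite t0E !tE//; last exact: lt_le_trans sv v1.
rewrite distrC; apply/ltW/Hd2; rewrite /ball/= ltr_norml; lra.
Qed.

Lemma beta_mixture_constant (y : R) : 0 < y -> y < 1 -> Phi y = C.
Proof.
move=> y0 y1; have bC : bmf (fun _ : measurableTypeR R => C) by exact: bmf_cst.
apply/eqP; rewrite eq_le; apply/andP; split.
  rewrite -subr_le0; apply: (@nonpos (fun y => Phi y - C)) => //.
  - exact: bmfB.
  - by move=> x; apply: cvgB; [exact: cPhi|exact: cvg_cst].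
  move=> a ba ac; have [M [lawM intM]] := mix ba ac; exists M; split => //.
  by rewrite bmf_intB// intM prob_int_cst subrr.
rewrite -subr_le0; apply: (@nonpos (fun y => C - Phi y)) => //.
- exact: bmfB.
- by move=> x; apply: cvgB; [exact: cvg_cst|exact: cPhi].
move=> a ba ac; have [M [lawM intM]] := mix ba ac; exists M; split => //.
by rewrite bmf_intB// intM prob_int_cst subrr.
Qed.

End beta_mixtures.

(** * Equality and stability of the laws *)

Section bounded_continuous.
Context (R : realType).
Implicit Types (P Q : probability (measurableTypeR R) R).

Lemma eq_law_int d (T : measurableType d) (P Q : probability T R) (f : T -> R) :
  (forall A, measurable A -> P A = Q A) -> \int[P]_x f x = \int[Q]_x f x.
Proof.
by move=> PQ; congr fine; apply: eq_measure_integral => A mA _; exact: PQ.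
Qed.

Lemma continuous_bmf (f : measurableTypeR R -> R) (M : R) :
  continuous (f : R -> R) -> (forall x, `|f x| <= M) -> bmf f.
Proof.
by move=> cf fM; split; [exact: (@continuous_measurable_fun R f)|exists M].
Qed.

(** Continuous functions with values in [0, 1] that increase to the indicator of ]r, +oo[; through
    them continuous test functions determine the masses of rays, a generating pi-system. *)
Let ramp (r : R) n (x : R) : R := Num.min 1 (n%:R * Num.max 0 (x - r)).

Let ramp_continuous r n : continuous (ramp r n).
Proof.
move=> x; apply: (@continuous_min _ _ (fun=> 1) (fun x => n%:R * Num.max 0 (x - r)) x).
  exact: cvg_cst.
apply: cvgM; first exact: cvg_cst.
apply: (@continuous_max _ _ (fun=> 0) (fun x => x - r) x); first exact: cvg_cst.
by apply: cvgB; [exact: cvg_id|exact: cvg_cst].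
Qed.

Let ramp_bound r n x : `|ramp r n x| <= 1.
Proof.
rewrite ger0_norm /ramp ?ge_min ?lexx// le_min ler01 mulr_ge0//.
by rewrite le_max lexx.
Qed.

Let ramp_cvg r x : ramp r n x @[n --> \oo] --> (\1_(`]r, +oo[%classic : set R) x : R).
Proof.
rewrite indicE; case: (boolP (_ \in _)); last first.
  rewrite notin_setE/= in_itv/= andbT => /negP; rewrite -leNgt => xr.
  have -> : ramp r ^~ x = fun=> 0; last exact: cvg_cst.
  apply/funext => n; rewrite /ramp max_l ?subr_le0// mulr0.
  by apply/min_r.
rewrite inE/= in_itv/= andbT => rx.
have : (fun=> 1) @ \oo --> (1 : R) by exact: cvg_cst.
apply: cvg_trans; apply: near_eq_cvg; near=> n.
rewrite /ramp max_r ?subr_ge0 ?(ltW rx)//; apply/esym/min_l.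
rewrite -ler_pdivrMr ?subr_gt0// mul1r.
near: n; exact: nbhs_infty_ger.
Unshelve. all: by end_near. Qed.

Lemma eq_law_of_continuous P Q :
  (forall f : R -> R, continuous f -> bmf (f : measurableTypeR R -> R) ->
    \int[P]_x f x = \int[Q]_x f x) ->
  eq_law P Q.
Proof.
move=> PQ A mA.
have ray r : P `]r, +oo[%classic = Q `]r, +oo[%classic.
  have mr : measurable (`]r, +oo[%classic : set (measurableTypeR R)) by exact: measurable_itv.
  have bn n : bmf (ramp r n : measurableTypeR R -> R).
    exact: (continuous_bmf (@ramp_continuous r n) (ramp_bound r n)).
  have lim (m : probability (measurableTypeR R) R) :
      \int[m]_x ramp r n x @[n --> \oo] --> fine (m `]r, +oo[%classic).
    have -> : fine (m `]r, +oo[%classic) =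
        \int[m]_x (\1_(`]r, +oo[%classic : set (measurableTypeR R)) x : R).
      by rewrite /Rintegral integral_indic// setIT.
    apply: (@bmf_dct _ _ _ m (ramp r) _ 1) => //.
    - by move=> n; case: (bn n).
    - by apply: nearW => x; exact: ramp_cvg.
  rewrite -[LHS]fineK ?fin_num_measure// -[RHS]fineK ?fin_num_measure//; congr EFin.
  apply: (cvg_unique _ (lim P)) => //.
  rewrite (_ : (fun n => _) = fun n => \int[Q]_x ramp r n x); first exact: lim.
  by apply/funext => n; apply: PQ; [exact: ramp_continuous|exact: bn].
apply: (@measure_unique _ R (measurableTypeR R) (@RGenOInfty.G R)
  (fun n => `](- n%:R), +oo[%classic) _ _ _ _ P Q) => //.
- exact: RGenOInfty.measurableE.
- move=> _ _ [x ->] [y ->]; exists (Num.max x y).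
  by apply/seteqP; split => z /=; rewrite !in_itv/= !andbT gt_max;
    [move=> [-> ->]|move/andP].
- by move=> n; exists (- n%:R).
- apply/seteqP; split => // x _.
  have [n xn] : exists n : nat, - x < n%:R.
    by exists (Num.bound `|x|); apply: (@le_lt_trans _ _ `|x|);
      [rewrite -normrN ler_norm|exact: archi_boundP].
  by exists n => //=; rewrite in_itv/= andbT ltrNl.
- by move=> _ [x ->]; exact: ray.
- by move=> n; exact: (le_lt_trans (probability_le1 _ _) (ltry _)).
Qed.

(** Continuity in a real parameter is tested along sequences so that [bmf_dct] applies. *)
Lemma cvg_seqP (f : R -> R) (p l : R) :
  (forall u : nat -> R, u n @[n --> \oo] --> p -> f (u n) @[n --> \oo] --> l) ->
  f x @[x --> p] --> l.
Proof. by move=> h; apply/(@cvg_nbhsP R^o R^o f p l) => u up; exact: h. Qed.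

End bounded_continuous.

(** * The law of B and stability under mixing *)

Section stability.
Context (R : realType).
Implicit Types (alpha nu : probability (measurableTypeR R) R).

Let mid : measurable_fun setT (fun x : measurableTypeR R => x).
Proof. by []. Qed.

Lemma continuous_mixture alpha nu (f : R -> R) :
  continuous f -> bmf (f : measurableTypeR R -> R) ->
  continuous (fun y : R => \int[alpha]_b \int[nu]_x f (y * b + (1 - y) * x)).
Proof.
move=> cf bf y; have [_ [M fM]] := bf; apply: cvg_seqP => u uy.
apply: (@bmf_dct _ _ _ alpha _ _ M) => //.
- by move=> n; have [] := bmf_mix_int_section nu alpha (u n) mid bf.
- by have [] := bmf_mix_int_section nu alpha y mid bf.
- by move=> n b; apply: bmf_int_norm => //; exact: bmf_mix_section.
apply: nearW => b; apply: (@bmf_dct _ _ _ nu _ _ M) => //.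
- by move=> n; have [] := bmf_mix_section (u n) b mid bf.
- by have [] := bmf_mix_section y b mid bf.
apply: nearW => x.
apply: (@cvg_comp _ _ _ (fun n => u n * b + (1 - u n) * x) f _ (nbhs (y * b + (1 - y) * x))).
  apply: cvgD; apply: cvgM => //; try exact: cvg_cst.
  by apply: cvgB => //; exact: cvg_cst.
exact: cf.
Qed.

Variables (alpha nu : probability (measurableTypeR R) R) (b c : R).
Hypotheses (b0 : 0 <= b) (bc : b < c).
Hypothesis hmu : forall a : R, b < a -> a < c -> is_mu a alpha nu.

Let mixture (f : R -> R) : continuous f -> bmf (f : measurableTypeR R -> R) ->
  forall y, 0 < y -> y < 1 ->
  \int[alpha]_b \int[nu]_x f (y * b + (1 - y) * x) = \int[nu]_x f x.
Proof.
move=> cf bf y y0 y1.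
apply: (@beta_mixture_constant R b c _
  (fun y => \int[alpha]_b \int[nu]_x f (y * b + (1 - y) * x))) => //.
- move=> a ba ac; have [M [lawM fixM]] := is_mu_fixed_point (hmu ba ac).
  by exists M; split => //; rewrite -fixM.
- exact: (bmf_mix_int2 nu alpha mid bf).
- exact: continuous_mixture.
Qed.

Lemma is_mu_interval_law : eq_law alpha nu.
Proof.
apply: eq_law_of_continuous => f cf bf.
have -> : \int[alpha]_x f x = \int[alpha]_b \int[nu]_x f (1 * b + (1 - 1) * x).
  apply: eq_Rintegral => x _; under [RHS]eq_Rintegral do rewrite subrr mul0r addr0 mul1r.
  by rewrite prob_int_cst.
(* Here y is the weight of B, so s -> 0 in the overview means y -> 1. The shift [n.+2] keeps u 0 = 1
   / 2 inside ]0, 1[. *)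
pose u n : R := 1 - (n.+2)%:R^-1.
have cu : u n @[n --> \oo] --> (1 : R).
  rewrite -[X in _ --> X]subr0; apply: cvgB; first exact: cvg_cst.
  have := @cvg_harmonic R; rewrite -(cvg_shiftS _ (nbhs (0 : R))).
  by [].
have h := cvg_comp _ _ cu (@continuous_mixture alpha nu f cf bf 1).
apply: (cvg_unique _ h) => //.
rewrite (_ : _ \o u = fun=> \int[nu]_x f x); first exact: cvg_cst.
apply/funext => n; apply: mixture => //=.
- by rewrite subr_gt0 invf_lt1// ltr1n.
- by rewrite gtrBl invr_gt0.
Qed.

Lemma is_mu_interval_stable (f : R -> R) (y : R) :
  continuous f -> bmf (f : measurableTypeR R -> R) -> 0 < y -> y < 1 ->
  \int[nu]_u \int[nu]_x f (y * u + (1 - y) * x) = \int[nu]_x f x.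
Proof.
move=> cf bf y0 y1; rewrite -(mixture cf bf y0 y1); apply/esym.
by apply: eq_law_int => A mA; exact: is_mu_interval_law.
Qed.

End stability.

(** * The resolvent identity *)

Section uniform_integral.
Context (R : realType).

Lemma integral_FTC_is_derive (u w : R) (F k : R -> R) : u < w ->
  continuous k -> (forall s, u <= s <= w -> is_derive s 1 F (k s)) ->
  (\int[lebesgue_measure]_(s in `[u, w]) (k s)%:E = (F w)%:E - (F u)%:E)%E.
Proof.
move=> uw ck dF.
have cF s : u <= s <= w -> F x @[x --> s] --> F s.
  move=> /dF [dFs _]; apply: differentiable_continuous.
  exact/derivable1_diffP.
have ckuw : {within `[u, w], continuous k} by apply: continuous_subspaceT.
rewrite (@continuous_FTC2 R k F u w uw)//.
- split.
  + move=> s; rewrite in_itv/= => /andP[us sw].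
    by have [] := dF s; rewrite ?(ltW us) ?(ltW sw).
  + by apply: cvg_at_right_filter; apply: cF; rewrite lexx ltW.
  + by apply: cvg_at_left_filter; apply: cF; rewrite lexx ltW.
- move=> s; rewrite in_itv/= => /andP[us sw].
  by rewrite derive1E; have [_ ->] := dF s ltac:(by rewrite ltW//= ltW).
Qed.

(** Averaging under [uniform_prob] instead of integrating against Lebesgue measure keeps every
    integral under a probability, so that [bmf_fubini] applies. *)
Lemma Rintegral_uniform_FTC (u w : R) (uw : u < w) (F k : R -> R) :
  bmf (k : measurableTypeR R -> R) ->
  continuous k -> (forall s, u <= s <= w -> is_derive s 1 F (k s)) ->
  \int[uniform_prob uw]_s k s = (F w - F u) / (w - u).
Proof.
move=> bk ck dF; have [mk [M kM]] := bk.
(* A shift to a nonnegative integrand; it adds M s to the primitive. *)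
pose k' s := k s + M.
have bk' : bmf (k' : measurableTypeR R -> R) by apply: bmfD => //; exact: bmf_cst.
have k'0 s : (0 <= (k' s)%:E)%E.
  by rewrite lee_fin /k'; have := kM s; rewrite ler_norml; lra.
have ck' : continuous k' by move=> s; apply: cvgD; [exact: ck|exact: cvg_cst].
have dF' s : u <= s <= w -> is_derive s 1 (fun s => F s + M * s) (k' s).
  move=> /dF H; apply: is_derive_eq.
  by rewrite /k' scaler1.
have I : \int[uniform_prob uw]_s k' s = (w - u)^-1 * (F w + M * w - (F u + M * u)).
  rewrite /Rintegral integral_uniform//; last by case: bk' => ? _; exact/measurable_EFinP.
  by rewrite (integral_FTC_is_derive uw ck' dF') -EFinB -EFinM.
move: I; rewrite bmf_intD//; last exact: bmf_cst.
rewrite [X in _ + X](prob_int_cst (uniform_prob uw)) => /(canRL (addrK _)) ->.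
by field; rewrite subr_eq0 gt_eqF.
Qed.

End uniform_integral.

(* Real and imaginary parts of 1 / (a + i y) and 1 / (a + i y)^2. *)
Definition re_inv (R : realType) (a y : R) : R := a / (a ^+ 2 + y ^+ 2).
Definition im_inv (R : realType) (a y : R) : R := - y / (a ^+ 2 + y ^+ 2).
Definition re_inv2 (R : realType) (a y : R) : R :=
  (a ^+ 2 - y ^+ 2) / (a ^+ 2 + y ^+ 2) ^+ 2.
Definition im_inv2 (R : realType) (a y : R) : R :=
  - (2 * a * y) / (a ^+ 2 + y ^+ 2) ^+ 2.

Section complex_inverse.
Context (R : realType).
Implicit Types a y m : R.

Lemma sqnorm_gt0 a y : 0 < y -> 0 < a ^+ 2 + y ^+ 2.
Proof. by move=> y0; rewrite ltr_wpDl ?sqr_ge0// exprn_gt0. Qed.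

Lemma re_inv_bound a y m : 0 < m -> m <= y -> `|re_inv a y| <= m^-1.
Proof.
move=> m0 my; have y0 : 0 < y by lra.
have D0 := sqnorm_gt0 a y0.
rewrite /re_inv normrM normfV [X in _ / X]gtr0_norm// ler_pdivrMr// mulrC ler_pdivlMr//.
rewrite -[a ^+ 2](real_normK (num_real a)); have := normr_ge0 a.
by move: `|a| => k k0; have := sqr_ge0 (k - y); rewrite !expr2; nra.
Qed.

Lemma im_inv_bound a y m : 0 < m -> m <= y -> `|im_inv a y| <= m^-1.
Proof.
move=> m0 my; have y0 : 0 < y by lra.
have D0 := sqnorm_gt0 a y0.
rewrite /im_inv normrM normfV [X in _ / X]gtr0_norm// normrN gtr0_norm//.
by rewrite ler_pdivrMr// mulrC ler_pdivlMr//; have := sqr_ge0 a; rewrite !expr2; nra.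
Qed.

Lemma re_inv2E a y : 0 < y -> re_inv2 a y = re_inv a y ^+ 2 - im_inv a y ^+ 2.
Proof.
move=> /(sqnorm_gt0 a) D0; rewrite /re_inv2 /re_inv /im_inv.
by field; rewrite gt_eqF.
Qed.

Lemma im_inv2E a y : 0 < y -> im_inv2 a y = 2 * re_inv a y * im_inv a y.
Proof.
move=> /(sqnorm_gt0 a) D0; rewrite /im_inv2 /re_inv /im_inv.
by field; rewrite gt_eqF.
Qed.

Lemma re_inv2_bound a y m : 0 < m -> m <= y -> `|re_inv2 a y| <= 2 / m ^+ 2.
Proof.
move=> m0 my; rewrite re_inv2E; last lra.
have h1 := re_inv_bound a m0 my; have h2 := im_inv_bound a m0 my.
move: (re_inv a y) (im_inv a y) h1 h2 => r i h1 h2.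
rewrite (le_trans (ler_normB _ _))// !normrX.
have -> : 2 / m ^+ 2 = m^-1 ^+ 2 + m^-1 ^+ 2 by field; rewrite gt_eqF.
by rewrite lerD// lerXn2r// nnegrE invr_ge0 ltW.
Qed.

Lemma im_inv2_bound a y m : 0 < m -> m <= y -> `|im_inv2 a y| <= 2 / m ^+ 2.
Proof.
move=> m0 my; rewrite im_inv2E; last lra.
have h1 := re_inv_bound a m0 my; have h2 := im_inv_bound a m0 my.
move: (re_inv a y) (im_inv a y) h1 h2 => r i h1 h2.
rewrite !normrM ger0_norm//.
have -> : 2 / m ^+ 2 = 2 * m^-1 * m^-1 by field; rewrite gt_eqF.
by rewrite -!mulrA ler_pM2l// ler_pM.
Qed.

Section measurability.
Context d (T : measurableType d) (a y : T -> R).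
Hypotheses (ma : measurable_fun setT a) (my : measurable_fun setT y).

Let mV : measurable_fun setT (fun t => (a t ^+ 2 + y t ^+ 2)^-1).
Proof.
under eq_fun do rewrite -powR_inv1 ?addr_ge0 ?sqr_ge0//.
apply: (@measurableT_comp _ _ _ _ _ _ (fun x : R => x `^ (-1))).
  exact: measurable_powR.
by apply: measurable_funD; exact: measurable_funX.
Qed.

Lemma measurable_re_inv : measurable_fun setT (fun t => re_inv (a t) (y t)).
Proof. exact: measurable_funM. Qed.

Lemma measurable_im_inv : measurable_fun setT (fun t => im_inv (a t) (y t)).
Proof. by apply: measurable_funM => //; exact: measurableT_comp. Qed.

Lemma measurable_re_inv2 : measurable_fun setT (fun t => re_inv2 (a t) (y t)).
Proof.
rewrite /re_inv2; under eq_fun do rewrite -exprVn.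
apply: measurable_funM; last exact: measurable_funX.
by apply: measurable_funB; exact: measurable_funX.
Qed.

Lemma measurable_im_inv2 : measurable_fun setT (fun t => im_inv2 (a t) (y t)).
Proof.
rewrite /im_inv2; under eq_fun do rewrite -exprVn.
apply: measurable_funM; last exact: measurable_funX.
apply: measurableT_comp => //; apply: measurable_funM => //.
exact: measurable_funM.
Qed.

End measurability.

Section convergence.
Context (T : Type) (F : set_system T) (FF : Filter F) (a y : T -> R) (a0 y0 : R).
Hypotheses (ca : a @ F --> a0) (cy : y @ F --> y0) (y00 : 0 < y0).

Let c2 : (fun t => a t ^+ 2 + y t ^+ 2) @ F --> a0 ^+ 2 + y0 ^+ 2.
Proof. by apply: cvgD; apply: cvgM. Qed.

Lemma cvg_im_inv : (fun t => im_inv (a t) (y t)) @ F --> im_inv a0 y0.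
Proof.
apply: cvgM; first exact: cvgN.
by apply: cvgV => //; rewrite gt_eqF ?sqnorm_gt0.
Qed.

Lemma cvg_re_inv2 : (fun t => re_inv2 (a t) (y t)) @ F --> re_inv2 a0 y0.
Proof.
apply: cvgM; first by apply: cvgB; apply: cvgM.
by apply: cvgV; [rewrite expf_neq0// gt_eqF ?sqnorm_gt0|apply: cvgM].
Qed.

Lemma cvg_im_inv2 : (fun t => im_inv2 (a t) (y t)) @ F --> im_inv2 a0 y0.
Proof.
apply: cvgM; first by apply: cvgN; apply: cvgM => //; apply: cvgM => //; exact: cvg_cst.
by apply: cvgV; [rewrite expf_neq0// gt_eqF ?sqnorm_gt0|apply: cvgM].
Qed.

End convergence.

(* With A = a1 + i y1, B = a2 + i y2, the function s / (B (s A + (1 - s) B)) is a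
   primitive of 1 / (s A + (1 - s) B)^2. *)
Section segment.
Variables (a1 y1 a2 y2 : R).
Let as_ (s : R) := s * a1 + (1 - s) * a2.
Let ys_ (s : R) := s * y1 + (1 - s) * y2.
Let D (s : R) := as_ s ^+ 2 + ys_ s ^+ 2.

Let dquot (N : R -> R) (dN s : R) : is_derive s 1 N dN -> D s != 0 ->
  is_derive s 1 (fun s => N s / D s)
   ((dN * D s - N s * (2 * as_ s * (a1 - a2) + 2 * ys_ s * (y1 - y2))) / D s ^+ 2).
Proof.
move=> HN D0.
have HD : is_derive s 1 D (2 * as_ s * (a1 - a2) + 2 * ys_ s * (y1 - y2)).
  by apply: is_derive_eq; rewrite /GRing.scale/= /as_ /ys_; ring.
have HV := is_deriveV D0 HD.
by apply: is_derive_eq; rewrite /GRing.scale/=; field.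
Qed.

(** With Z = s A + (1 - s) B, the primitive s / (B Z) is s times the conjugate of B Z over |B|^2
    |Z|^2, and a2 as - y2 ys is the real part of B Z. *)
Lemma is_derive_re_segment (s : R) : 0 < y2 -> 0 < ys_ s ->
  is_derive s 1 (fun s => s * (a2 * as_ s - y2 * ys_ s) / (a2 ^+ 2 + y2 ^+ 2) / D s)
    (re_inv2 (as_ s) (ys_ s)).
Proof.
move=> y20 ys0; have B0 : a2 ^+ 2 + y2 ^+ 2 != 0 by rewrite gt_eqF ?sqnorm_gt0.
have D0 : D s != 0 by rewrite gt_eqF ?sqnorm_gt0.
have HN : is_derive s 1 (fun s => s * (a2 * as_ s - y2 * ys_ s) / (a2 ^+ 2 + y2 ^+ 2))
   (((a2 * as_ s - y2 * ys_ s) + s * (a2 * (a1 - a2) - y2 * (y1 - y2))) /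
    (a2 ^+ 2 + y2 ^+ 2)).
  by apply: is_derive_eq; rewrite /GRing.scale/= /as_ /ys_; field.
apply: (is_derive_eq (dquot HN D0)).
rewrite /re_inv2 -/(D s); move: D0 B0; rewrite /D /as_ /ys_ => D0 B0.
by field; rewrite D0 B0.
Qed.

Lemma is_derive_im_segment (s : R) : 0 < y2 -> 0 < ys_ s ->
  is_derive s 1 (fun s => - (s * (a2 * ys_ s + y2 * as_ s)) / (a2 ^+ 2 + y2 ^+ 2) / D s)
    (im_inv2 (as_ s) (ys_ s)).
Proof.
move=> y20 ys0; have B0 : a2 ^+ 2 + y2 ^+ 2 != 0 by rewrite gt_eqF ?sqnorm_gt0.
have D0 : D s != 0 by rewrite gt_eqF ?sqnorm_gt0.
have HN : is_derive s 1 (fun s => - (s * (a2 * ys_ s + y2 * as_ s)) / (a2 ^+ 2 + y2 ^+ 2))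
   (- ((a2 * ys_ s + y2 * as_ s) + s * (a2 * (y1 - y2) + y2 * (a1 - a2))) /
    (a2 ^+ 2 + y2 ^+ 2)).
  by apply: is_derive_eq; rewrite /GRing.scale/= /as_ /ys_; field.
apply: (is_derive_eq (dquot HN D0)).
rewrite /im_inv2 -/(D s); move: D0 B0; rewrite /D /as_ /ys_ => D0 B0.
by field; rewrite D0 B0.
Qed.

End segment.
End complex_inverse.

Section clamp.
Context (R : realType).

Definition clamp01 (s : R) : R := Num.max 0 (Num.min 1 s).

Lemma clamp01_itv s : 0 <= clamp01 s <= 1.
Proof. by rewrite /clamp01 le_max lexx/= ge_max ler01/= ge_min lexx. Qed.

Lemma clamp01E s : 0 <= s <= 1 -> clamp01 s = s.
Proof. by move=> /andP[s0 s1]; rewrite /clamp01 min_r// max_r. Qed.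

Lemma continuous_clamp01 : continuous clamp01.
Proof.
move=> x.
have H1 : {for x, continuous ((fun=> 1) \min (fun x : R => x))}.
  by apply: (@continuous_min R R (fun=> 1) (fun x => x) x); [exact: cvg_cst|exact: cvg_id].
exact: (@continuous_max R R (fun=> 0) _ x (@cvg_cst _ _ _ _ _) H1).
Qed.

Lemma measurable_clamp01 d (T : measurableType d) (s : T -> R) :
  measurable_fun setT s -> measurable_fun setT (fun t => clamp01 (s t)).
Proof. by move=> ms; apply: measurable_maxr => //; exact: measurable_minr. Qed.

Lemma segment_ge (s y1 y2 : R) : 0 <= s <= 1 ->
  Num.min y1 y2 <= s * y1 + (1 - s) * y2.
Proof.
move=> /andP[s0 s1].
have h1 : Num.min y1 y2 <= y1 by rewrite ge_min lexx.
have h2 : Num.min y1 y2 <= y2 by rewrite ge_min lexx orbT.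
by move: (Num.min y1 y2) h1 h2 => m h1 h2; nra.
Qed.

End clamp.

Lemma bmf_int_gt0 d (T : measurableType d) (R : realType) (P : probability T R)
    (f : T -> R) :
  bmf f -> (forall x, 0 < f x) -> 0 < \int[P]_x f x.
Proof.
move=> bf f0; rewrite lt_neqAle Rintegral_ge0 ?andbT; last by move=> x _; exact: ltW.
apply/negP => /eqP/esym I0.
have mf : measurable_fun setT (EFin \o f) by case: bf => ? _; exact/measurable_EFinP.
have [H _] := @ae_eq_integral_abs _ _ _ P _ measurableT _ mf.
have : (\int[P]_x `|(EFin \o f) x| = 0)%E.
  rewrite (eq_integral (EFin \o f)); first by rewrite -EFin_bmf_int// I0.
  by move=> x _ /=; rewrite ger0_norm// ltW.
case/H => N [mN N0 sN].
have NT : N = setT.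
  apply/seteqP; split => // x _; apply: sN => /= /(_ I) /eqP.
  by rewrite eqe gt_eqF.
by move: (probability_setT P); rewrite -NT N0 => /esym/eqP; rewrite onee_eq0.
Qed.

(** * From stability to the product formula *)

Section resolvent.
Context (R : realType) (nu : probability (measurableTypeR R) R).
Hypothesis stable : forall (f : R -> R) (y : R),
  continuous f -> bmf (f : measurableTypeR R -> R) -> 0 < y -> y < 1 ->
  \int[nu]_u \int[nu]_x f (y * u + (1 - y) * x) = \int[nu]_x f x.

Let stable01 (f : R -> R) (y : R) :
  continuous f -> bmf (f : measurableTypeR R -> R) -> 0 <= y <= 1 ->
  \int[nu]_u \int[nu]_x f (y * u + (1 - y) * x) = \int[nu]_x f x.
Proof.
move=> cf bf; rewrite le_eqVlt [y <= 1]le_eqVlt.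
case/andP => /predU1P[<- _|y0 /predU1P[->|y1]].
- rewrite -[RHS](prob_int_cst nu); apply: eq_Rintegral => u _.
  by apply: eq_Rintegral => x _; rewrite mul0r add0r subr0 mul1r.
- apply: eq_Rintegral => u _; rewrite -[RHS](prob_int_cst nu).
  by apply: eq_Rintegral => x _; rewrite subrr mul0r addr0 mul1r.
- exact: stable.
Qed.

Variables (v1 y1 v2 y2 : R).
Hypotheses (y10 : 0 < y1) (y20 : 0 < y2).

Let m : R := Num.min y1 y2.
Let m0 : 0 < m. Proof. by rewrite lt_min y10 y20. Qed.

Let U := uniform_prob (@ltr01 R).

Section kernel.
(** [K] stands for [re_inv2] or [im_inv2]; both parts share the exchange of integrals. *)
Variable K : R -> R -> R.
Hypothesis Kb : forall a y m, 0 < m -> m <= y -> `|K a y| <= 2 / m ^+ 2.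
Hypothesis mK : forall d (T : measurableType d) (a y : T -> R),
  measurable_fun setT a -> measurable_fun setT y ->
  measurable_fun setT (fun t => K (a t) (y t)).
Hypothesis cK : forall (T : Type) (F : set_system T) (FF : Filter F)
    (a y : T -> R) (a0 y0 : R),
  a @ F --> a0 -> y @ F --> y0 -> 0 < y0 ->
  (fun t => K (a t) (y t)) @ F --> K a0 y0.

(* Without clamp01, s * y1 + (1 - s) * y2 could vanish, and the integrands be
   unbounded, outside the support [0, 1] of U. *)
Let A (s w1 w2 : R) := K (clamp01 s * w1 + (1 - clamp01 s) * w2)
  (clamp01 s * y1 + (1 - clamp01 s) * y2).

Let ys_ge s : m <= clamp01 s * y1 + (1 - clamp01 s) * y2.
Proof. by apply: segment_ge; exact: clamp01_itv. Qed.

Let ys_gt0 s : 0 < clamp01 s * y1 + (1 - clamp01 s) * y2.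
Proof. exact: lt_le_trans m0 (ys_ge s). Qed.

Let bmfA d (T : measurableType d) (s w1 w2 : T -> R) :
  measurable_fun setT s -> measurable_fun setT w1 -> measurable_fun setT w2 ->
  bmf (fun t => A (s t) (w1 t) (w2 t)).
Proof.
move=> ms mw1 mw2; split; last by exists (2 / m ^+ 2) => t; exact: Kb.
have mc := measurable_clamp01 ms.
by apply: mK; apply: measurable_funD; apply: measurable_funM => //; exact: measurable_funB.
Qed.

(** For fixed s the integrand depends on u and x only through s u + (1 - s) x, which has law [nu]
    under the product; on the diagonal this combination is x itself. Fubini brings s outside and
    back. *)
Lemma kernel_transfer :
  \int[nu]_u \int[nu]_x \int[U]_s A s (v1 - u) (v2 - x) =
  \int[nu]_x \int[U]_s A s (v1 - x) (v2 - x).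
Proof.
have mB d (T : measurableType d) (v : R) (w : T -> measurableTypeR R) :
    measurable_fun setT w -> measurable_fun setT (fun t => v - w t : R).
  by move=> mw; exact: measurable_funB.
transitivity (\int[nu]_u \int[U]_s \int[nu]_x A s (v1 - u) (v2 - x)).
  apply: eq_Rintegral => u _.
  apply: (@bmf_fubini _ _ _ _ _ nu U (fun p => A p.2 (v1 - u) (v2 - p.1))).
  by apply: bmfA => //; exact: mB.
rewrite (@bmf_fubini _ _ _ _ _ nu U
  (fun p => \int[nu]_x A p.2 (v1 - p.1) (v2 - x))); last first.
  apply: (@bmf_int1 _ _ _ _ _ (nu \x U)%E nu (fun q => A q.1.2 (v1 - q.1.1) (v2 - q.2))).
  apply: bmfA; [|apply: mB|apply: mB] => //; exact: measurableT_comp.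
rewrite -(@bmf_fubini _ _ _ _ _ U nu (fun p => A p.1 (v1 - p.2) (v2 - p.2))); last first.
  by apply: bmfA => //; exact: mB.
apply: eq_Rintegral => s _ /=.
pose f (w : R) := K (clamp01 s * v1 + (1 - clamp01 s) * v2 - w)
  (clamp01 s * y1 + (1 - clamp01 s) * y2).
have cf : continuous f.
  move=> w; apply: cK => //; last exact: cvg_cst.
  by apply: cvgB; [exact: cvg_cst|exact: cvg_id].
have bf : bmf (f : measurableTypeR R -> R).
  split; last by exists (2 / m ^+ 2) => w; exact: Kb.
  by apply: mK => //; exact: mB.
have := stable01 cf bf (clamp01_itv s).
set I1 := \int[nu]_u _; set I2 := \int[nu]_x _ => e.
transitivity I1.
  apply: eq_Rintegral => u _; apply: eq_Rintegral => x _.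
  by rewrite /A /f; congr K; ring.
rewrite e; apply: eq_Rintegral => x _.
by rewrite /A /f; congr K; ring.
Qed.

Lemma kernel_integral (w1 w2 : R) (F : R -> R) :
  (forall s, 0 <= s <= 1 -> 0 < s * y1 + (1 - s) * y2 ->
    is_derive s 1 F (K (s * w1 + (1 - s) * w2) (s * y1 + (1 - s) * y2))) ->
  \int[U]_s A s w1 w2 = F 1 - F 0.
Proof.
move=> dF.
have bA : bmf (fun s : measurableTypeR R => A s w1 w2) by apply: bmfA.
have cA : continuous (fun s => A s w1 w2).
  move=> s; have cs := @continuous_clamp01 R s.
  apply: cK => //; apply: cvgD; apply: cvgM; try exact: cvg_cst; try exact: cs.
    by apply: cvgB; [exact: cvg_cst|exact: cs].
  by apply: cvgB; [exact: cvg_cst|exact: cs].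
have dA (s : R) : 0 <= s <= 1 -> is_derive s 1 F (A s w1 w2).
  move=> s01; rewrite /A clamp01E//; apply: dF => //.
  by rewrite -(clamp01E s01).
by have := Rintegral_uniform_FTC ltr01 bA cA dA; rewrite subr0 divr1.
Qed.

End kernel.

Let re1 x := re_inv (v1 - x) y1.
Let re2 x := re_inv (v2 - x) y2.
Let im1 x := im_inv (v1 - x) y1.
Let im2 x := im_inv (v2 - x) y2.

Let b_re (v y : R) : 0 < y -> bmf (fun x : measurableTypeR R => re_inv (v - x) y).
Proof.
move=> y0; split; last by exists y^-1 => x; exact: re_inv_bound.
by apply: measurable_re_inv => //; exact: measurable_funB.
Qed.

Let b_im (v y : R) : 0 < y -> bmf (fun x : measurableTypeR R => im_inv (v - x) y).
Proof.
move=> y0; split; last by exists y^-1 => x; exact: im_inv_bound.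
by apply: measurable_im_inv => //; exact: measurable_funB.
Qed.

Let bre1 := b_re v1 y10.
Let bre2 := b_re v2 y20.
Let bim1 := b_im v1 y10.
Let bim2 := b_im v2 y20.

Let prod_int (f g : measurableTypeR R -> R) : bmf f -> bmf g ->
  \int[nu]_u \int[nu]_x (f u * g x) = \int[nu]_x f x * \int[nu]_x g x.
Proof.
move=> bf bg; rewrite -bmf_intZr//; apply: eq_Rintegral => u _.
by rewrite bmf_intZl.
Qed.

Let prod_int_bmf (f g : measurableTypeR R -> R) : bmf f -> bmf g ->
  bmf (fun u => \int[nu]_x (f u * g x)).
Proof.
move=> bf bg.
have -> : (fun u => \int[nu]_x (f u * g x)) = (fun u => f u * \int[nu]_x g x).
  by apply/funext => u; rewrite bmf_intZl.
by apply: bmfM => //; exact: bmf_cst.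
Qed.

(** [L] evaluates the average over s as the real part of 1 / (A B). In [kernel_transfer] the
    independent pair then yields products of integrals, and the diagonal the integral of the
    product. *)
Lemma re_product_integral :
  \int[nu]_x (re1 x * re2 x - im1 x * im2 x) =
  \int[nu]_x re1 x * \int[nu]_x re2 x - \int[nu]_x im1 x * \int[nu]_x im2 x.
Proof.
have L w1 w2 : \int[U]_s re_inv2 (clamp01 s * w1 + (1 - clamp01 s) * w2)
      (clamp01 s * y1 + (1 - clamp01 s) * y2) =
    re_inv w1 y1 * re_inv w2 y2 - im_inv w1 y1 * im_inv w2 y2.
  rewrite (kernel_integral (@re_inv2_bound R) (@measurable_re_inv2 R) (@cvg_re_inv2 R)
    (fun s _ ys => @is_derive_re_segment R w1 y1 w2 y2 s y20 ys)).
  have h1 := sqnorm_gt0 w1 y10; have h2 := sqnorm_gt0 w2 y20.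
  rewrite subrr !mul1r !mul0r !addr0 subr0 /re_inv /im_inv.
  by field; rewrite !gt_eqF.
have := kernel_transfer (@re_inv2_bound R) (@measurable_re_inv2 R) (@cvg_re_inv2 R).
under [X in _ = X -> _]eq_Rintegral do rewrite L.
move=> <-; rewrite -!prod_int// -bmf_intB; [|exact: prod_int_bmf..].
apply: eq_Rintegral => u _; rewrite -bmf_intB; last 2 first.
- by apply: bmfM => //; exact: bmf_cst.
- by apply: bmfM => //; exact: bmf_cst.
by apply: eq_Rintegral => x _; rewrite L.
Qed.

Lemma im_product_integral :
  \int[nu]_x (re1 x * im2 x + im1 x * re2 x) =
  \int[nu]_x re1 x * \int[nu]_x im2 x + \int[nu]_x im1 x * \int[nu]_x re2 x.
Proof.
have L w1 w2 : \int[U]_s im_inv2 (clamp01 s * w1 + (1 - clamp01 s) * w2)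
      (clamp01 s * y1 + (1 - clamp01 s) * y2) =
    re_inv w1 y1 * im_inv w2 y2 + im_inv w1 y1 * re_inv w2 y2.
  rewrite (kernel_integral (@im_inv2_bound R) (@measurable_im_inv2 R) (@cvg_im_inv2 R)
    (fun s _ ys => @is_derive_im_segment R w1 y1 w2 y2 s y20 ys)).
  have h1 := sqnorm_gt0 w1 y10; have h2 := sqnorm_gt0 w2 y20.
  rewrite subrr !mul1r !mul0r !addr0 oppr0 !mul0r subr0 /re_inv /im_inv.
  by field; rewrite !gt_eqF.
have := kernel_transfer (@im_inv2_bound R) (@measurable_im_inv2 R) (@cvg_im_inv2 R).
under [X in _ = X -> _]eq_Rintegral do rewrite L.
move=> <-; rewrite -!prod_int// -bmf_intD; [|exact: prod_int_bmf..].
apply: eq_Rintegral => u _; rewrite -bmf_intD; last 2 first.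
- by apply: bmfM => //; exact: bmf_cst.
- by apply: bmfM => //; exact: bmf_cst.
by apply: eq_Rintegral => x _; rewrite L.
Qed.

(* The real and imaginary parts of G(z1) - G(z2) = (z2 - z1) G(z1) G(z2) for the
   Stieltjes transform G(z) = E[1 / (z - X)]. *)
Lemma re_resolvent :
  \int[nu]_x re1 x - \int[nu]_x re2 x =
  (v2 - v1) * (\int[nu]_x re1 x * \int[nu]_x re2 x - \int[nu]_x im1 x * \int[nu]_x im2 x)
  - (y2 - y1) * (\int[nu]_x re1 x * \int[nu]_x im2 x + \int[nu]_x im1 x * \int[nu]_x re2 x).
Proof.
rewrite -re_product_integral -im_product_integral -bmf_intB//.
have br : bmf (fun x => re1 x * re2 x - im1 x * im2 x) by apply: bmfB; exact: bmfM.
have bi : bmf (fun x => re1 x * im2 x + im1 x * re2 x) by apply: bmfD; exact: bmfM.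
rewrite -!bmf_intZl// -bmf_intB; [|by apply: bmfM => //; exact: bmf_cst..].
(* Pointwise this is the partial fraction identity for 1 / ((z1 - x) (z2 - x)). *)
apply: eq_Rintegral => x _; rewrite /re1 /re2 /im1 /im2 /re_inv /im_inv.
have h1 := sqnorm_gt0 (v1 - x) y10; have h2 := sqnorm_gt0 (v2 - x) y20.
by field; rewrite !gt_eqF.
Qed.

Lemma im_resolvent :
  \int[nu]_x im1 x - \int[nu]_x im2 x =
  (v2 - v1) * (\int[nu]_x re1 x * \int[nu]_x im2 x + \int[nu]_x im1 x * \int[nu]_x re2 x)
  + (y2 - y1) * (\int[nu]_x re1 x * \int[nu]_x re2 x - \int[nu]_x im1 x * \int[nu]_x im2 x).
Proof.
rewrite -re_product_integral -im_product_integral -bmf_intB//.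
have br : bmf (fun x => re1 x * re2 x - im1 x * im2 x) by apply: bmfB; exact: bmfM.
have bi : bmf (fun x => re1 x * im2 x + im1 x * re2 x) by apply: bmfD; exact: bmfM.
rewrite -!bmf_intZl// -bmf_intD; [|by apply: bmfM => //; exact: bmf_cst..].
apply: eq_Rintegral => x _; rewrite /re1 /re2 /im1 /im2 /re_inv /im_inv.
have h1 := sqnorm_gt0 (v1 - x) y10; have h2 := sqnorm_gt0 (v2 - x) y20.
by field; rewrite !gt_eqF.
Qed.

End resolvent.

(** * Identification of the law *)

Section poisson_kernel.
Context (R : realType).
Implicit Types (nu : probability (measurableTypeR R) R) (v y p q : R).

(** This is - Im 1 / (a + i y), and pi times the centred Cauchy density of scale y; its integral at
    v - x under [nu] is - Im G(v + i y). *)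
Definition poisson_kernel (y a : R) : R := y / (a ^+ 2 + y ^+ 2).

Lemma poisson_kernelE y a : poisson_kernel y a = - im_inv a y.
Proof. by rewrite /poisson_kernel /im_inv mulNr opprK. Qed.

Lemma poisson_kernel_gt0 y a : 0 < y -> 0 < poisson_kernel y a.
Proof. by move=> y0; rewrite divr_gt0// sqnorm_gt0. Qed.

Lemma poisson_kernel_bound y a : 0 < y -> `|poisson_kernel y a| <= y^-1.
Proof. by move=> y0; rewrite poisson_kernelE normrN im_inv_bound. Qed.

Lemma measurable_poisson_kernel y d (T : measurableType d) (a : T -> R) :
  measurable_fun setT a -> measurable_fun setT (fun t => poisson_kernel y (a t)).
Proof.
move=> ma; under eq_fun do rewrite poisson_kernelE.
by apply: measurableT_comp => //; exact: measurable_im_inv.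
Qed.

Lemma bmf_poisson_kernel y d (T : measurableType d) (a : T -> R) : 0 < y ->
  measurable_fun setT a -> bmf (fun t => poisson_kernel y (a t)).
Proof.
move=> y0 ma; split; first exact: measurable_poisson_kernel.
by exists y^-1 => t; exact: poisson_kernel_bound.
Qed.

Lemma continuous_poisson_kernel y : 0 < y -> continuous (poisson_kernel y).
Proof.
move=> y0 a; rewrite (_ : poisson_kernel y = fun a => - im_inv a y); last first.
  by apply/funext => b; rewrite poisson_kernelE.
by apply: cvgN; apply: cvg_im_inv => //; exact: cvg_cst.
Qed.

Lemma is_derive_atan_poisson (y p s : R) : 0 < y ->
  is_derive s 1 (fun v => atan ((v - p) / y)) (poisson_kernel y (s - p)).
Proof.
move=> y0; apply: is_derive_eq; rewrite /GRing.scale/= /poisson_kernel.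
have := sqnorm_gt0 (s - p) y0 => D0; have : 0 < 1 + ((s - p) / y) ^+ 2.
  by rewrite ltr_wpDr// sqr_ge0.
move=> E0; field; rewrite !gt_eqF//=.
Qed.

End poisson_kernel.

(** * Solving for the transform and inverting it *)

Section stable_law.
Context (R : realType) (nu : probability (measurableTypeR R) R).

Let mB (v : R) : measurable_fun setT (fun x : measurableTypeR R => v - x : R).
Proof. exact: measurable_funB. Qed.

Lemma stable_poisson_transform :
  (forall (f : R -> R) (y : R),
    continuous f -> bmf (f : measurableTypeR R -> R) -> 0 < y -> y < 1 ->
    \int[nu]_u \int[nu]_x f (y * u + (1 - y) * x) = \int[nu]_x f x) ->
  exists p q : R, 0 <= q /\ forall v y, 0 < y ->
    0 < y + q /\ \int[nu]_x poisson_kernel y (v - x) = poisson_kernel (y + q) (v - p).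
Proof.
move=> stable.
have PE v y : 0 < y -> \int[nu]_x poisson_kernel y (v - x) = - \int[nu]_x im_inv (v - x) y.
  move=> y0; rewrite -mulN1r -bmf_intZl.
    by apply: eq_Rintegral => x _; rewrite poisson_kernelE mulN1r.
  by split; [exact: measurable_im_inv|exists y^-1 => x; exact: im_inv_bound].
have W0 v y : 0 < y -> \int[nu]_x im_inv (v - x) y < 0.
  move=> y0; rewrite -oppr_gt0 -PE//; apply: bmf_int_gt0.
    exact: bmf_poisson_kernel.
  by move=> x; exact: poisson_kernel_gt0.
(* The base point is z1 = i: [U1] and [W1] are the parts of G(i), and [p], [q] below are chosen so
   that 1 / G(i) = i - p + i q. *)
pose U1 := \int[nu]_x re_inv (0 - x) 1; pose W1 := \int[nu]_x im_inv (0 - x) 1.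
have W10 : W1 < 0 by exact: W0.
pose N1 := U1 ^+ 2 + W1 ^+ 2.
have N10 : 0 < N1 by rewrite ltr_wpDl ?sqr_ge0// exprn_even_gt0//= lt_eqF.
pose p := - U1 / N1; pose q := - W1 / N1 - 1.
have main v y : 0 < y -> 0 < y + q /\
    \int[nu]_x poisson_kernel y (v - x) = poisson_kernel (y + q) (v - p).
  move=> y0.
  have E1 := re_resolvent stable 0 v ltr01 y0.
  have E2 := im_resolvent stable 0 v ltr01 y0.
  move: E1 E2; rewrite -/U1 -/W1; have := W0 v y y0.
  set U2 := \int[nu]_x re_inv (v - x) y; set W2 := \int[nu]_x im_inv (v - x) y.
  move=> W20 E1 E2.
  rewrite PE// -/W2.
  have pE : p * N1 = - U1 by rewrite /p divfK// gt_eqF.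
  have qE : q * N1 = - W1 - N1 by rewrite /q mulrBl mul1r divfK// gt_eqF.
  (* [F1] and [F2] are the real and imaginary parts of G(z) (z - p + i q) = 1. They come from the
     resolvent identity multiplied by the conjugate of G(i), with N1 = |G(i)|^2. *)
  have F1 : U2 * (v - p) - W2 * (y + q) = 1.
    apply: (mulIf (lt0r_neq0 N10)); rewrite mul1r.
    have -> : (U2 * (v - p) - W2 * (y + q)) * N1 =
      U2 * v * N1 - U2 * (p * N1) - W2 * y * N1 - W2 * (q * N1) by ring.
    rewrite pE qE; move: (congr1 (fun z => z * U1) E1) (congr1 (fun z => z * W1) E2) => /=.
    by rewrite /N1; lra.
  have F2 : U2 * (y + q) + W2 * (v - p) = 0.
    apply: (mulIf (lt0r_neq0 N10)); rewrite mul0r.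
    have -> : (U2 * (y + q) + W2 * (v - p)) * N1 =
      U2 * y * N1 + U2 * (q * N1) + W2 * v * N1 - W2 * (p * N1) by ring.
    rewrite pE qE; move: (congr1 (fun z => z * W1) E1) (congr1 (fun z => z * U1) E2) => /=.
    by rewrite /N1; lra.
  have F3 : - W2 * ((v - p) ^+ 2 + (y + q) ^+ 2) = y + q.
    rewrite -[RHS]mulr1 -[X in _ = _ * X]F1 -[LHS]addr0 -[X in _ + X](mulr0 (v - p)) -F2.
    by ring.
  have S0 : 0 < (v - p) ^+ 2 + (y + q) ^+ 2.
    rewrite lt_neqAle addr_ge0 ?sqr_ge0// andbT eq_sym paddr_eq0 ?sqr_ge0//.
    rewrite !sqrf_eq0; apply/negP => /andP[/eqP e1 /eqP e2].
    by move: F1; rewrite e1 e2 !mulr0 subrr => /esym/eqP; rewrite oner_eq0.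
  split; first by rewrite -F3 mulr_gt0// oppr_gt0.
  by rewrite /poisson_kernel -[X in X / _]F3 mulfK// gt_eqF.
exists p, q; split; last exact: main.
rewrite leNgt; apply/negP => q0.
(* Positivity of y + q for every y > 0 would fail at y = - q. *)
have [] := main 0 (- q); first by rewrite oppr_gt0.
by rewrite addNr ltxx.
Qed.

Variables (p q : R).
Hypothesis transform : forall v y, 0 < y ->
  \int[nu]_x poisson_kernel y (v - x) = poisson_kernel (y + q) (v - p).

Let cvg_inv : (n.+1%:R^-1 : R) @[n --> \oo] --> (0 : R).
Proof. exact: cvg_harmonic. Qed.

Let invS_gt0 n : 0 < (n.+1%:R^-1 : R). Proof. by rewrite invr_gt0. Qed.

(** y times the Poisson kernel equals y^2 / (a^2 + y^2): it is at most 1 and tends to the indicator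
    of a = 0 as y -> 0. *)
Let atom_limit (x0 : R) :
  n.+1%:R^-1 * poisson_kernel (n.+1%:R^-1 + q) (x0 - p) @[n --> \oo] -->
  fine (nu [set x0]).
Proof.
have ms : measurable ([set x0] : set (measurableTypeR R)) by exact: measurable_set1.
have -> : fine (nu [set x0]) =
    \int[nu]_x (\1_([set x0] : set (measurableTypeR R)) x : R).
  by rewrite /Rintegral integral_indic// setIT.
rewrite (_ : (fun n => _) =
    fun n => \int[nu]_x (n.+1%:R^-1 * poisson_kernel n.+1%:R^-1 (x0 - x))); last first.
  apply/funext => n; rewrite -transform//.
  by rewrite (bmf_intZl nu _ (bmf_poisson_kernel (invS_gt0 n) (mB x0))).
apply: (@bmf_dct _ _ _ nu _ _ 1) => //.
- by move=> n; apply: measurable_funM => //; exact: measurable_poisson_kernel.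
- move=> n x; rewrite normrM gtr0_norm// -ler_pdivlMl ?invr_gt0// mulr1.
  exact: poisson_kernel_bound.
apply: nearW => x; rewrite indicE.
have [->|xx0] := eqVneq x x0.
  rewrite mem_set//= (_ : (fun n => _) = fun=> 1); first exact: cvg_cst.
  apply/funext => n; rewrite /poisson_kernel subrr expr0n/= add0r.
  by have := invS_gt0 n; move: (_^-1) => z z0; field; rewrite gt_eqF.
rewrite memNset//=; last by move/eqP; apply/negP.
have d0 : 0 < (x0 - x) ^+ 2 by rewrite exprn_even_gt0//= subr_eq0 eq_sym.
rewrite -[X in _ --> X](mul0r (poisson_kernel 0 (x0 - x))); apply: cvgM => //.
apply: cvgM => //; apply: cvgV.
  by rewrite expr0n/= addr0 gt_eqF.
by apply: cvgD; [exact: cvg_cst|exact: cvgM].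
Qed.

(** With q = 0 the sequence of [atom_limit] at [p] is constantly 1, so all the mass sits at [p]. *)
Lemma dirac_of_transform : q = 0 -> eq_law nu (dirac (p : measurableTypeR R)).
Proof.
move=> qE; have ms : measurable ([set p] : set (measurableTypeR R)) by exact: measurable_set1.
have n1 : nu [set p] = 1%E.
  rewrite -[LHS]fineK ?fin_num_measure//; congr EFin.
  apply: (cvg_unique _ (@atom_limit p)) => //.
  rewrite (_ : (fun n => _) = fun=> 1); first exact: cvg_cst.
  apply/funext => n; rewrite qE addr0 /poisson_kernel subrr expr0n/= add0r.
  by have := invS_gt0 n; move: (_^-1) => z z0; field; rewrite gt_eqF.
move=> A mA; rewrite diracE.
have [pA|pA] := boolP (p \in A).
  apply/eqP; rewrite eq_le probability_le1//= -n1 le_measure ?inE//.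
  by move=> _ ->; rewrite inE in pA.
have : (nu A + nu [set p] <= 1)%E.
  rewrite -measureU//; first by apply: probability_le1; exact: measurableU.
  by apply/seteqP; split => // x [/= Ax xp]; move: pA; rewrite notin_setE -xp.
rewrite n1 => h; apply/eqP; rewrite -measure_le0.
by move: h; rewrite -[X in (_ <= X)%E]add0e leeD2rE.
Qed.

Section positive_scale.
Hypothesis q_gt0 : 0 < q.

(** For q > 0 the transform stays below 1 / q, so y times it tends to 0. *)
Let no_atom (x0 : R) : nu [set x0] = 0%E.
Proof.
rewrite -[LHS]fineK; last by apply: fin_num_measure; exact: measurable_set1.
congr EFin; apply: (cvg_unique _ (@atom_limit x0)) => //.
apply: (@squeeze_cvgr _ _ _ _ (fun=> 0) (fun n => n.+1%:R^-1 * q^-1)).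
- apply: nearW => n; have yq : 0 < n.+1%:R^-1 + q by rewrite addr_gt0.
  rewrite mulr_ge0 ?(ltW (poisson_kernel_gt0 _ _))//= ler_pM2l//.
  apply: le_trans (ler_norm _) _; apply: le_trans (poisson_kernel_bound _ yq) _.
  by rewrite lef_pV2 ?posrE// lerDr.
- exact: cvg_cst.
- rewrite -[X in _ --> X](mul0r q^-1); apply: cvgM => //; exact: cvg_cst.
Qed.

Variables (u w : R).
Hypothesis uw : u < w.

(** The integral of [poisson_kernel y (v - x)] over v in [u, w]. As y -> 0 it tends to pi inside the
    interval and to 0 outside; the endpoints, where the limit is pi / 2, are null by [no_atom]. *)
Let D (y x : R) : R := atan ((w - x) / y) - atan ((u - x) / y).

Let D_bound y x : `|D y x| <= pi.
Proof.
rewrite ler_norml /D.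
have := atan_gtNpi2 ((w - x) / y); have := atan_ltpi2 ((w - x) / y).
have := atan_gtNpi2 ((u - x) / y); have := atan_ltpi2 ((u - x) / y).
by move=> *; apply/andP; split; lra.
Qed.

Let measurable_D (y : R) : measurable_fun setT (D y : measurableTypeR R -> R).
Proof.
have matan (v : R) : measurable_fun setT (fun x : measurableTypeR R => atan ((v - x) / y)).
  apply: (@measurableT_comp _ _ _ _ _ _ (@atan R)).
    by apply: continuous_measurable_fun => z; exact: continuous_atan.
  by apply: measurable_funM => //; exact: measurable_funB.
exact: measurable_funB.
Qed.

Let atan_average y : 0 < y ->
  \int[nu]_x D y x = atan ((w - p) / (y + q)) - atan ((u - p) / (y + q)).
Proof.
move=> y0; have wu0 : w - u != 0 by rewrite subr_eq0 gt_eqF.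
have avg z (t : R) : 0 < z ->
    \int[uniform_prob uw]_v poisson_kernel z (v - t) =
    (atan ((w - t) / z) - atan ((u - t) / z)) / (w - u).
  move=> z0; apply: (@Rintegral_uniform_FTC R u w uw (fun v => atan ((v - t) / z))).
  - apply: bmf_poisson_kernel => //; exact: measurable_funB.
  - move=> v; apply: (@cvg_comp _ _ _ (fun v => v - t) (poisson_kernel z) _ (nbhs (v - t))).
      by apply: cvgB; [exact: cvg_id|exact: cvg_cst].
    exact: continuous_poisson_kernel.
  - by move=> v _; exact: is_derive_atan_poisson.
apply: (mulIf (invr_neq0 wu0)).
rewrite -avg ?addr_gt0//.
transitivity (\int[nu]_x \int[uniform_prob uw]_v poisson_kernel y (v - x)).
  rewrite -bmf_intZr; first by apply: eq_Rintegral => x _; rewrite avg.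
  by split; [exact: measurable_D|exists pi].
rewrite (@bmf_fubini _ _ _ _ _ nu (uniform_prob uw)
  (fun z => poisson_kernel y (z.2 - z.1))).
  by apply: eq_Rintegral => v _; exact: transform.
by apply: bmf_poisson_kernel => //; exact: measurable_funB.
Qed.

Let cvg_atan_pos (a : R) : 0 < a -> atan (a / n.+1%:R^-1) @[n --> \oo] --> pi / 2.
Proof.
move=> a0; have h : (a / n.+1%:R^-1) @[n --> \oo] --> +oo.
  apply/cvgryPge => A; apply: filterS (nbhs_infty_ger (A / a)) => n An.
  by rewrite invrK mulrC -ler_pdivrMr// (le_trans An)// ler_nat.
exact: (cvg_comp _ _ h (@cvgy_atan R)).
Qed.

Let cvg_atan_neg (a : R) : a < 0 -> atan (a / n.+1%:R^-1) @[n --> \oo] --> - (pi / 2).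
Proof.
move=> a0; rewrite (_ : (fun n => _) = fun n => - atan (- a / n.+1%:R^-1)).
  by apply: cvgN; apply: cvg_atan_pos; rewrite oppr_gt0.
by apply/funext => n; rewrite mulNr atanN opprK.
Qed.

Lemma transform_interval :
  nu `]u, w]%classic = (pi^-1 * (atan ((w - p) / q) - atan ((u - p) / q)))%:E.
Proof.
have mI : measurable (`]u, w]%classic : set (measurableTypeR R)) by exact: measurable_itv.
have pi0 := pi_gt0 R; have uw' := uw.
rewrite -[LHS]fineK ?fin_num_measure//; congr EFin.
apply: (mulfI (lt0r_neq0 pi0)); rewrite mulrA mulfV ?gt_eqF// mul1r.
have -> : pi * fine (nu `]u, w]%classic) =
    \int[nu]_x (pi * \1_(`]u, w]%classic : set (measurableTypeR R)) x).
  rewrite bmf_intZl; first by rewrite /Rintegral integral_indic// setIT.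
  split; first exact: measurable_indic.
  by exists 1 => x; rewrite indicE; case: (_ \in _); rewrite ?normr1 ?normr0.
have lhs : \int[nu]_x D n.+1%:R^-1 x @[n --> \oo] -->
    \int[nu]_x (pi * \1_(`]u, w]%classic : set (measurableTypeR R)) x).
  apply: (@bmf_dct _ _ _ nu _ _ pi) => //.
  - by apply: measurable_funM => //; exact: measurable_indic.
  exists ([set u] `|` [set w]); split.
  - by apply: measurableU; exact: measurable_set1.
  - rewrite measureU0; [exact: no_atom|..|exact: no_atom];
      exact: measurable_set1.
  move=> x /=; apply: contra_notP => /not_orP[/= /eqP xu /eqP xw].
  rewrite indicE; have [xu'|ux|e] := ltgtP x u; last by rewrite e eqxx in xu.
  - rewrite memNset/=; last by rewrite in_itv/= ltNge (ltW xu').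
    rewrite mulr0 -(subrr (pi / 2)); apply: cvgB; apply: cvg_atan_pos; lra.
  have [xw'|wx|e] := ltgtP x w; last by rewrite e eqxx in xw.
  - rewrite mem_set/=; last by rewrite in_itv/= ux ltW.
    have -> : pi * true%:R = pi / 2 - - (pi / 2) :> R by rewrite /=; lra.
    by apply: cvgB; [apply: cvg_atan_pos|apply: cvg_atan_neg]; lra.
  - rewrite memNset/=; last by rewrite in_itv/= leNgt wx andbF.
    rewrite mulr0 -(subrr (- (pi / 2))); apply: cvgB; apply: cvg_atan_neg; lra.
apply: (cvg_unique _ lhs) => //.
rewrite (_ : (fun n => _) = fun n =>
    atan ((w - p) / (n.+1%:R^-1 + q)) - atan ((u - p) / (n.+1%:R^-1 + q))); last first.
  by apply/funext => n; exact: atan_average.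
have cat (v : R) : atan ((v - p) / (n.+1%:R^-1 + q)) @[n --> \oo] --> atan ((v - p) / q).
  apply: (@cvg_comp _ _ _ (fun n => (v - p) / (n.+1%:R^-1 + q)) (@atan R) _
    (nbhs ((v - p) / q))); last exact: continuous_atan.
  apply: cvgM; first exact: cvg_cst.
  apply: cvgV; first by rewrite gt_eqF.
  rewrite -[X in _ --> X]add0r; apply: cvgD => //; exact: cvg_cst.
by apply: cvgB; exact: cat.
Qed.

End positive_scale.
End stable_law.

Section density_measure.
Context d (T : measurableType d) (R : realType) (mu : {measure set T -> \bar R}).
Variable f : T -> R.

(** The proofs [mf] and [f0] are parameters because the measure structure attached below depends on
    them. *)
Definition density_measure (mf : measurable_fun setT f) (f0 : forall x, 0 <= f x)
  (A : set T) : \bar R := (\int[mu]_(x in A) (f x)%:E)%E.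

Hypotheses (mf : measurable_fun setT f) (f0 : forall x, 0 <= f x).
Local Notation m := (density_measure mf f0).

Let m_set0 : m set0 = 0%E.
Proof. exact: integral_set0. Qed.

Let m_ge0 A : (0 <= m A)%E.
Proof. by apply: integral_ge0 => x _; rewrite lee_fin. Qed.

Let m_sigma_additive : semi_sigma_additive m.
Proof.
move=> /= F mF tF mUF; rewrite /density_measure; apply: cvg_toP.
  apply: ereal_nondecreasing_is_cvgn => i j ij.
  by apply: lee_sum_nneg_natr => // k _ _; exact: m_ge0.
rewrite ge0_integral_bigcup//=.
- by apply: measurable_funTS; exact/measurable_EFinP.
- by move=> x _; rewrite lee_fin.
Qed.

HB.instance Definition _ := isMeasure.Build _ _ _ m m_set0 m_ge0 m_sigma_additive.

End density_measure.

Lemma cauchy_of_transform (R : realType)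
    (nu : probability (measurableTypeR R) R) (p q : R) :
  0 < q ->
  (forall v y, 0 < y ->
    \int[nu]_x poisson_kernel y (v - x) = poisson_kernel (y + q) (v - p)) ->
  is_cauchy nu.
Proof.
move=> q0 transform; exists p, q; split => // A mA.
pose f (x : measurableTypeR R) : R := pi^-1 * (q / ((x - p) ^+ 2 + q ^+ 2)).
have f0 x : 0 <= f x.
  rewrite mulr_ge0 ?invr_ge0 ?pi_ge0//.
  exact: ltW (poisson_kernel_gt0 (x - p) q0).
have mf : measurable_fun setT f.
  by apply: measurable_funM => //; apply: measurable_poisson_kernel; exact: measurable_funB.
(* It suffices to compare on half-open intervals, where [transform_interval] is the increment of
   pi^-1 atan((v - p) / q), a primitive of the Cauchy density. *)
apply: (@measure_unique _ R (measurableTypeR R) (@ocitv R)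
  (fun n => `](- n%:R), n%:R]%classic) _ _ _ _ nu
  (density_measure lebesgue_measure mf f0)) => //.
- exact: ocitvI.
- by move=> n; exact: is_ocitv.
- apply/seteqP; split => // x _; exists (Num.bound `|x|) => //=.
  have := archi_boundP (normr_ge0 x); rewrite in_itv/= => h.
  have := ltW h; rewrite ler_norml => /andP[_ ->].
  by rewrite andbT ltrNl (le_lt_trans _ h)// -normrN ler_norm.
- move=> I [[u w] _ <-] /=.
  have [uw|wu] := ltP u w; last by rewrite set_itv_ge ?bnd_simp -?leNgt// !measure0.
  rewrite (transform_interval transform q0 uw) /density_measure.
  have cf : continuous (f : R -> R).
    move=> x; apply: cvgM; first exact: cvg_cst.
    apply: (@cvg_comp _ _ _ (fun x => x - p) (poisson_kernel q) _ (nbhs (x - p))).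
      by apply: cvgB; [exact: cvg_id|exact: cvg_cst].
    exact: continuous_poisson_kernel.
  rewrite integral_itv_obnd_cbnd; last first.
    by apply: measurable_funTS; exact/measurable_EFinP.
  have df (s : R) : u <= s <= w ->
      is_derive s 1 (fun v => pi^-1 * atan ((v - p) / q)) (f s).
    by move=> _; have H := is_derive_atan_poisson p s q0; apply: is_derive_eq.
  by rewrite (integral_FTC_is_derive uw cf df) -EFinB mulrBr.
- by move=> n; exact: (le_lt_trans (probability_le1 _ _) (ltry _)).
Qed.

Theorem proposition6p4 (R : realType)
    (alpha nu : probability (measurableTypeR R) R) (b c : R)
    (halpha : FT1 alpha) (hb : 0 <= b) (hbc : b < c)
    (hmu : forall a : R, b < a -> a < c -> is_mu a alpha nu) :
  eq_law alpha nu /\ (is_cauchy alpha \/ is_dirac alpha).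
Proof.
have law := is_mu_interval_law hb hbc hmu; split => //.
have stable f y := @is_mu_interval_stable R alpha nu b c hb hbc hmu f y.
have [p [q [q0 H]]] := stable_poisson_transform stable.
have transform v y (y0 : 0 < y) := (H v y y0).2.
move: q0; rewrite le_eqVlt => /predU1P[q0|q0].
  right; exists p => A mA; rewrite law//.
  exact: (dirac_of_transform transform (esym q0)).
left; have [p' [q' [q'0 L]]] := cauchy_of_transform q0 transform.
by exists p', q'; split => // A mA; rewrite law// L.
Qed.
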